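(* Let $\mathcal{A}\subseteq \mathbb{N}^n$ be a finite set, and let $r$ be an extreme ray of the SONC cone $\mathcal{C}(\mathcal{A})$. Then $r$ is not exposed if and only if $r=\mathbb{R}_+\,\mathbf{x}^{\alpha}$ for some $\alpha\in\mathcal{A}$, and there exists a circuit $(S,\beta)$ on $\mathcal{A}$ such that $\alpha\in S$, $\beta\neq\alpha$, and $\beta$ is even.
   Context: $\mathbb{N}$ denotes the nonnegative integers and $\mathbb{R}_+$ the nonnegative reals. A point $\alpha\in\mathbb{N}^n$ is even if all its entries are even, i.e. $\alpha\in 2\mathbb{N}^n$. For $\alpha\in\mathbb{N}^n$, $\mathbf{x}^{\alpha}=x_1^{\alpha_1}\cdots x_n^{\alpha_n}$. For a finite set $\mathcal{A}\subseteq\mathbb{N}^n$, $\mathbb{R}[\mathcal{A}]$ denotes the real vector space of polynomials supported on $\mathcal{A}$, i.e. the real linear span of $\{\mathbf{x}^{\alpha}:\alpha\in\mathcal{A}\}$. A circuit on $\mathcal{A}$ is a pair $(S,\beta)$ where $S\subseteq\mathcal{A}\cap 2\mathbb{N}^n$ is a nonempty affinely independent set and $\beta\in\mathcal{A}$ lies in the relative interior of the convex hull $\mathrm{conv}(S)$ (the degenerate case $S=\{\beta\}$ is allowed). A circuit polynomial in $\mathbb{R}[\mathcal{A}]$ is a polynomial which is either of the form $f(\mathbf{x})=\sum_{\alpha\in S}c_{\alpha}\mathbf{x}^{\alpha}+d\,\mathbf{x}^{\beta}$ with $(S,\beta)$ a circuit on $\mathcal{A}$, $c_\alpha>0$ for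 all $\alpha\in S$ and $d\in\mathbb{R}$, or a sum of monomial squares, i.e. a combination with nonnegative coefficients of monomials $\mathbf{x}^{\alpha}$ with $\alpha\in\mathcal{A}\cap 2\mathbb{N}^n$. It is called nonnegative if $f(\mathbf{x})\ge 0$ for all $\mathbf{x}\in\mathbb{R}^n$. The SONC cone $\mathcal{C}(\mathcal{A})$ on the ground set $\mathcal{A}$ is the set of all finite nonnegative linear combinations of nonnegative circuit polynomials in $\mathbb{R}[\mathcal{A}]$. An extreme ray of a convex cone $K$ is a set $r=\mathbb{R}_+ v\subseteq K$ with $v\neq 0$ such that whenever $x\in r$ and $x=y+z$ with $y,z\in K$, one has $y,z\in\mathbb{R}_+ v$. A face $F$ (in particular an extreme ray) of a convex cone $K$ in a real vector space $X$ is exposed if there is a linear function $l\colon X\to\mathbb{R}$ with $l(x)=0$ for all $x\in F$ and $l(y)>0$ for all $y\in K\setminus F$. Here $K=\mathcal{C}(\mathcal{A})$ and $X=\mathbb{R}[\mathcal{A}]$. *)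

(* Defs.v *)
From mathcomp Require Import all_boot all_order all_algebra finmap.
From mathcomp Require Import mpoly.
From mathcomp Require Import classical_sets reals topology normedtype.

Set Implicit Arguments.
Unset Strict Implicit.
Unset Printing Implicit Defensive.

Import Order.TTheory GRing.Theory Num.Theory numFieldNormedType.Exports.

Local Open Scope ring_scope.
Local Open Scope classical_set_scope.

Section Convex.
Variables (R : realType) (V : lmodType R).
Implicit Types (P X K r F : set V) (v : V).

Definition conv_hull P : set V := [set x | exists (k : nat)
  (lam : 'I_k -> R) (p : 'I_k -> V),
  [/\ forall i, 0 <= lam i, \sum_i lam i = 1, forall i, P (p i)
    & x = \sum_i lam i *: p i]].

Definition aff_hull P : set V := [set x | exists (k : nat)
  (lam : 'I_k -> R) (p : 'I_k -> V),
  [/\ \sum_i lam i = 1, forall i, P (p i) & x = \sum_i lam i *: p i]].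

Definition ray v : set V := [set x | exists2 t : R, 0 <= t & x = t *: v].

Definition extreme_ray K r : Prop := exists v,
  [/\ v != 0, r = ray v, r `<=` K
    & forall x y z, r x -> x = y + z -> K y -> K z -> ray v y /\ ray v z].

(* A linear form on the subspace X is given by a function on V whose values
   outside X are irrelevant. *)
Definition linear_form_on X (l : V -> R) : Prop :=
  forall (a : R) x y, X x -> X y -> l (a *: x + y) = a * l x + l y.

Definition exposed X K F : Prop := exists l : V -> R,
  [/\ linear_form_on X l, forall x, F x -> l x = 0
    & forall y, (K `\` F) y -> 0 < l y].

End Convex.

Definition relint (R : realType) (n : nat) (C : set 'rV[R]_n) :
    set 'rV[R]_n :=
  [set x | C x /\ \forall y \near x, aff_hull C y -> C y].

Section Sonc.
Variables (R : realType) (n : nat).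
Implicit Types (A S : {fset 'X_{1..n}}) (a b : 'X_{1..n}) (f : {mpoly R[n]}).

Definition even_mnm a : bool := [forall i, ~~ odd (a i)].

Definition point a : 'rV[R]_n := \row_i (a i)%:R.

Definition points S : set 'rV[R]_n := [set point a | a in [set` S]].

Definition affinely_independent S : Prop := forall lam : 'X_{1..n} -> R,
  \sum_(a <- S) lam a = 0 -> \sum_(a <- S) lam a *: point a = 0 ->
  forall a, a \in S -> lam a = 0.

Definition polys_on A : set {mpoly R[n]} :=
  [set f | {subset msupp f <= A}].

Definition circuit A S b : Prop :=
  [/\ S != fset0, (S `<=` A)%fset, {in S, forall a, even_mnm a},
      affinely_independent S & b \in A /\ relint (conv_hull (points S)) (point b)].

Definition monomial_square_sum A f : Prop := exists c : 'X_{1..n} -> R,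
  (forall a, 0 <= c a) /\ f = \sum_(a <- A | even_mnm a) c a *: 'X_[a].

Definition circuit_poly A f : Prop :=
  (exists S b (c : 'X_{1..n} -> R) (d : R),
     [/\ circuit A S b, {in S, forall a, 0 < c a}
       & f = \sum_(a <- S) c a *: 'X_[a] + d *: 'X_[b]])
  \/ monomial_square_sum A f.

Definition nonneg_poly f : Prop := forall x : 'I_n -> R, 0 <= f.@[x].

Definition sonc A : set {mpoly R[n]} := [set f | exists (k : nat)
  (lam : 'I_k -> R) (g : 'I_k -> {mpoly R[n]}),
  [/\ forall i, 0 <= lam i,
      forall i, circuit_poly A (g i) /\ nonneg_poly (g i)
    & f = \sum_i lam i *: g i]].

End Sonc.

(* Main.v *)
Require Import Defs.
From mathcomp Require Import all_boot all_order all_algebra finmap.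
From mathcomp Require Import mpoly.
From mathcomp Require Import classical_sets reals.
From mathcomp Require Import boolp topology normedtype sequences exp.
From mathcomp Require Import ring lra.

(** The cone is generated by the even monomials and by the AM-GM polynomials
    [\sum_a lam a * exp (h a) * x^a + s * exp (\sum_a lam a * h a) * x^b] attached to
    a circuit with barycentric weights [lam] ([sonc_ind]): these are the circuit
    polynomials that attain the circuit number bound, and their nonnegativity is
    Jensen's inequality for the exponential. An extreme ray is spanned by one of
    these generators ([extreme_ray_generator]), so two kinds of rays remain.

    The ray of a monomial [x^a]. If [a] belongs to the support of a circuit with
    an even inner point [b] different from [a], then the AM-GM polynomials of this
    circuit approach [x^a] with a coefficient of [x^b] that tends to zero more
    slowly than the coefficients of the other outer monomials. A linear form which
    vanishes on [x^a] and is positive on [x^b] becomes negative on them, so the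
    ray is not exposed ([monomial_not_exposed]). If there is no such circuit, the
    form with values [exp |c|^2] on the even exponents [c] other than [a], and zero
    on all other exponents, exposes the ray, because [|c|^2] is strictly convex
    ([monomial_exposed]).

    The ray of an AM-GM polynomial is always exposed ([amgm_exposed]). Evaluation
    at a zero of the polynomial is nonnegative on the cone, but it may vanish on
    other AM-GM polynomials too. Extremality forces the circuit to be reduced: its
    simplex contains no even point of the ground set besides the vertices and
    possibly the inner point ([reduced_circuit]). Hence the values of the
    evaluation on monomials can be multiplied by [exp Q], where [Q] is zero on the
    simplex and is, off the simplex, a strictly convex function that is positive at
    the points of the ground set ([peak_function]); the perturbed form is positive
    on all other generators. *)

Set Implicit Arguments.
Unset Strict Implicit.
Unset Printing Implicit Defensive.

Import Order.TTheory GRing.Theory Num.Theory numFieldNormedType.Exports.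

Local Open Scope ring_scope.
Local Open Scope classical_set_scope.

(** * Affine forms and barycentric coordinates *)

Section AffineForms.
Variables (R : realType) (n : nat).
Local Notation pt := (@Defs.point R n).
Implicit Types (A S : {fset 'X_{1..n}}) (a b : 'X_{1..n}).
Implicit Types (lam mu h : 'X_{1..n} -> R) (x y : 'rV[R]_n).

Definition affine_form (c : R) (u : 'cV[R]_n) y : R := c + (y *m u) 0 0.

Lemma affine_form_sum (I : Type) (s : seq I) (l : I -> R) (p : I -> 'rV[R]_n) c u :
  \sum_(i <- s) l i = 1 ->
  affine_form c u (\sum_(i <- s) l i *: p i)
  = \sum_(i <- s) l i * affine_form c u (p i).
Proof.
move=> l1; rewrite /affine_form mulmx_suml summxE.
under [RHS]eq_bigr do rewrite mulrDr.
rewrite big_split /= -mulr_suml l1 mul1r; congr (_ + _).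
by apply: eq_bigr => i _; rewrite -scalemxAl mxE.
Qed.

Lemma affine_form_line c u x v t :
  affine_form c u (x + t *: (x - v))
  = affine_form c u x + t * (affine_form c u x - affine_form c u v).
Proof.
rewrite /affine_form mulmxDl -scalemxAl mulmxBl !mxE; ring.
Qed.

(** A point of the relative interior is exploited by moving slightly along a
    line through it. *)
Lemma near_line x v (P : set 'rV[R]_n) :
  (\forall y \near x, P y) -> exists2 t : R, 0 < t & P (x + t *: v).
Proof.
move=> /nbhs_ballP [e /= e0 xP].
pose s := 1 + \sum_j `|v 0 j|.
have s0 : 0 < s by rewrite ltr_pwDl// sumr_ge0.
exists (e / s); first by rewrite divr_gt0.
apply: xP; split=> // i j; rewrite ord1 /ball/= !mxE opprD addNKr normrN normrM.
rewrite gtr0_norm ?divr_gt0// mulrAC ltr_pdivrMr// ltr_pM2l//.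
rewrite /s (bigD1 j)//= addrCA ltrDl ltr_pwDl// sumr_ge0//.
Qed.

Lemma near_affine_form_gt0 c u x :
  0 < affine_form c u x -> \forall y \near x, 0 < affine_form c u y.
Proof.
set m := affine_form c u x => m0.
pose s := 1 + \sum_j `|u j 0|.
have s0 : 0 < s by rewrite ltr_pwDl// sumr_ge0.
apply/nbhs_ballP; exists (m / s); first by rewrite /= divr_gt0.
move=> y [_ xy].
have -> : affine_form c u y = m + \sum_j (y 0 j - x 0 j) * u j 0.
  rewrite /m /affine_form -addrA !mxE -big_split/=; congr (_ + _).
  by apply: eq_bigr => j _; ring.
rewrite -ltrBlDl sub0r ltrNl (le_lt_trans (ler_norm _))// normrN.
apply: (le_lt_trans (ler_norm_sum _ _ _)).
apply: (@le_lt_trans _ _ (m / s * \sum_j `|u j 0|)).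
  rewrite mulr_sumr ler_sum// => j _; rewrite normrM ler_wpM2r//.
  by have := xy 0 j; rewrite /ball/= distrC => /ltW.
by rewrite mulrAC ltr_pdivrMr// ltr_pM2l// /s ltrDr.
Qed.

Lemma near_all_in (T : eqType) (U : topologicalType) (s : seq T) (x : U) (P : T -> U -> Prop) :
  (forall i, i \in s -> \forall y \near x, P i y) ->
  \forall y \near x, forall i, i \in s -> P i y.
Proof.
elim: s => [|i s IH] Ps; first by near=> y.
have Pi : \forall y \near x, P i y by apply: Ps; rewrite mem_head.
have /IH Ps' : forall j, j \in s -> \forall y \near x, P j y.
  by move=> j js; apply: Ps; rewrite inE js orbT.
near=> y => j; rewrite inE => /predU1P[->|]; first by near: y.
by move: j; near: y.
Unshelve. all: by end_near.
Qed.

(** The matrix with rows [(1, point a)], for [a] in [S], has independent rows,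
    so it has a right inverse; column [a] of this inverse gives the constant and
    the linear part of the barycentric coordinate of [a], extended to the
    whole space. *)
Lemma dual_basis S : affinely_independent R S ->
  exists (c : 'X_{1..n} -> R) (u : 'X_{1..n} -> 'cV[R]_n),
  {in S &, forall a b, affine_form (c a) (u a) (pt b) = (a == b)%:R}.
Proof.
move=> indepS; pose s : seq _ := S; pose m := size s.
have sU : uniq s by apply: fset_uniq.
have [->|[a0 a0S]] := fset_0Vmem S.
  by exists (fun=> 0), (fun=> 0) => a b; rewrite inE.
pose e (i : 'I_m) : 'X_{1..n} := nth a0 s i.
pose M := row_mx (const_mx 1 : 'M[R]_(m, 1)) (\matrix_(i < m) pt (e i)).
have : row_free M.
  apply: inj_row_free => v; rewrite mul_mx_row => vM0.
  have /= := congr1 lsubmx vM0; rewrite row_mxKl linear0 => v1.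
  have /= := congr1 rsubmx vM0; rewrite row_mxKr linear0 => vP.
  pose lam a := if insub (index a s) is Some i then v 0 i else 0.
  have lamE i : lam (e i) = v 0 i.
    by rewrite /lam index_uniq// valK.
  have lam0 : forall a, a \in S -> lam a = 0.
    apply: indepS.
    - rewrite (big_nth a0) big_mkord; under eq_bigr do rewrite lamE.
      have := congr1 (fun N : 'M_1 => N 0 0) v1; rewrite !mxE => v1'.
      by rewrite -[RHS]v1'; apply: eq_bigr => i _; rewrite mxE mulr1.
    - rewrite (big_nth a0) big_mkord; under eq_bigr do rewrite lamE.
      rewrite -[RHS]vP mulmx_sum_row; apply: eq_bigr => i _.
      by rewrite rowK.
  apply/rowP => i; rewrite mxE -lamE lam0//; exact: mem_nth.
move=> /row_freeP[B MB].
have ind (a : 'X_{1..n}) : a \in S -> exists i, a = e i.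
  move=> aS; have ia : (index a s < m)%N by rewrite index_mem.
  by exists (Ordinal ia); rewrite /e/= nth_index.
pose B0 := usubmx B; pose B1 := dsubmx B.
have [i0 _] := ind _ a0S.
pose k a := odflt i0 (insub (index a s)).
exists (fun a => B0 0 (k a)), (fun a => col (k a) B1) => a b /ind[i ->] /ind[j ->].
have kE i' : k (e i') = i' by rewrite /k index_uniq// valK.
have eI : injective e by move=> i1 i2 e12; rewrite -(kE i1) e12 kE.
rewrite !kE (inj_eq eI) /affine_form mxE.
have /(congr1 (fun N : 'M_m => N j i)) :
    const_mx 1 *m B0 + (\matrix_(l < m) pt (e l)) *m B1 = 1%:M.
  by rewrite -mul_row_col vsubmxK.
rewrite !mxE eq_sym => <-; congr (_ + _).
  by rewrite big_ord1 !mxE mul1r.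
by apply: eq_bigr => l _; rewrite !mxE.
Qed.
End AffineForms.

(** * Circuits as convex weights *)

Section Weights.
Variables (R : realType) (n : nat).
Local Notation pt := (@Defs.point R n).
Implicit Types (A S : {fset 'X_{1..n}}) (a b : 'X_{1..n}).
Implicit Types (lam mu h : 'X_{1..n} -> R) (x y : 'rV[R]_n).

Lemma point_inj : injective pt.
Proof.
move=> a b /rowP ab; apply/mnmP => i; apply/eqP; rewrite -(eqr_nat R).
by have := ab i; rewrite !mxE => ->.
Qed.

Lemma sum_delta A a (V : lmodType R) (F : 'X_{1..n} -> V) : a \in A ->
  \sum_(c <- A) (c == a)%:R *: F c = F a.
Proof.
move=> aA; rewrite (big_fsetD1 a)//= eqxx scale1r big1_seq ?addr0// => c.
by rewrite !inE => /andP[_ /andP[/negPf -> _]]; rewrite scale0r.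
Qed.

Lemma sum_delta1 A a : a \in A -> \sum_(c <- A) (c == a)%:R = 1 :> R.
Proof.
move=> aA; have := sum_delta (fun=> 1 : R^o) aA.
by under eq_bigr do rewrite [_ *: _]mulr1.
Qed.

(** A circuit [(S, b)] is carried by the coefficients of [b] as a convex
    combination of [S], extended by zero: [S] is then the support of [lam], and
    all sums can range over the ground set [A]. *)
Definition weights A lam b : Prop :=
  [/\ forall a, 0 <= lam a, forall a, lam a != 0 -> (a \in A) && even_mnm a,
      \sum_(a <- A) lam a = 1 & \sum_(a <- A) lam a *: pt a = pt b].

(** Affine independence of the support of [lam], expressed with sums over [A]
    to match [weights]. *)
Definition indep_support A lam : Prop := forall mu, (forall a, lam a = 0 -> mu a = 0) ->
  \sum_(a <- A) mu a = 0 -> \sum_(a <- A) mu a *: pt a = 0 ->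
  forall a, mu a = 0.

Definition supp A lam : {fset 'X_{1..n}} := [fset a in A | lam a != 0]%fset.

Lemma in_supp A lam a : (forall a, lam a != 0 -> a \in A) ->
  (a \in supp A lam) = (lam a != 0).
Proof. by move=> lamA; rewrite !inE/= andb_idl// => /lamA. Qed.

Lemma sum_supp A lam (V : zmodType) (F : 'X_{1..n} -> V) :
  (forall a, lam a = 0 -> F a = 0) ->
  \sum_(a <- supp A lam) F a = \sum_(a <- A) F a.
Proof.
move=> F0; apply: big_fset_incl => [|a aA].
  by apply/fsubsetP => a; rewrite !inE => /andP[].
by rewrite !inE/= aA/= negbK => /eqP; exact: F0.
Qed.

Lemma indep_supportP A lam : (forall a, lam a != 0 -> a \in A) ->
  indep_support A lam <-> affinely_independent R (supp A lam).
Proof.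
move=> lamA.
split=> [ind mu s0 p0 a aS|ind mu mu0 s0 p0 a].
  pose nu a := if lam a == 0 then 0 else mu a.
  have nuE b : b \in supp A lam -> nu b = mu b.
    by rewrite in_supp// /nu; case: eqP.
  rewrite -nuE//; apply: ind => [b||]; first by rewrite /nu => ->; rewrite eqxx.
    rewrite -(@sum_supp A lam) => [|b]; last by rewrite /nu => ->; rewrite eqxx.
    by rewrite -[RHS]s0; apply: eq_big_seq.
  rewrite -(@sum_supp A lam) => [|b]; last by rewrite /nu => ->; rewrite eqxx scale0r.
  by rewrite -[RHS]p0; apply: eq_big_seq => b /nuE ->.
have [/mu0//|la] := eqVneq (lam a) 0.
apply: (ind mu); rewrite ?in_supp// sum_supp// => b /mu0 ->.
by rewrite scale0r.
Qed.

(** The constants [c] and linear parts [u] give the barycentric coordinates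
    for the support of [lam]; coordinates of points outside the support vanish
    identically, which keeps sums over [A] correct. *)
Definition bary_coords lam (c : 'X_{1..n} -> R) (u : 'X_{1..n} -> 'cV[R]_n) :=
  (forall a b, lam b != 0 -> affine_form (c a) (u a) (pt b) = (a == b)%:R)
  /\ (forall a y, lam a = 0 -> affine_form (c a) (u a) y = 0).

Lemma bary_coords_exist A lam : (forall a, lam a != 0 -> a \in A) ->
  indep_support A lam -> exists c u, bary_coords lam c u.
Proof.
move=> lamA /(indep_supportP lamA)/dual_basis[c [u cu]].
exists (fun a => if lam a == 0 then 0 else c a),
  (fun a => if lam a == 0 then 0 else u a); split=> [a b lb|a y la].
  have [la|la] := eqVneq (lam a) 0; last by rewrite cu// in_supp.
  rewrite /affine_form mulmx0 mxE addr0.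
  by case: eqP => // ab; rewrite -ab la eqxx in lb.
by rewrite la eqxx /affine_form mulmx0 mxE addr0.
Qed.

(** Affine forms commute with affine combinations, so affinely independent
    points determine the coefficients of any affine combination of them. *)
Lemma bary_coordsE A lam c u mu : (forall a, lam a != 0 -> a \in A) ->
  bary_coords lam c u -> (forall a, lam a = 0 -> mu a = 0) ->
  \sum_(a <- A) mu a = 1 ->
  forall a, affine_form (c a) (u a) (\sum_(a <- A) mu a *: pt a) = mu a.
Proof.
move=> lamA [cu1 cu0] mu0 mu1 a.
have [la|la] := eqVneq (lam a) 0; first by rewrite cu0// mu0.
rewrite affine_form_sum//.
have aA := lamA _ la.
rewrite (big_fsetD1 a)//= big1_seq ?addr0; last first.
  move=> b; rewrite !inE => /andP[_ /andP[ba _]].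
  have [lb|lb] := eqVneq (lam b) 0; first by rewrite mu0 // mul0r.
  by rewrite cu1// eq_sym (negPf ba) mulr0.
by rewrite cu1// eqxx mulr1.
Qed.

(** A hull is described by families of points with repetitions; adding the
    coefficients of equal points turns them into coefficients on [S]. *)
Lemma sum_fibers S (k : nat) (l : 'I_k -> R) (q : 'I_k -> 'X_{1..n}) (V : lmodType R)
    (F : 'X_{1..n} -> V) : (forall i, q i \in S) ->
  \sum_(a <- S) (\sum_(i | q i == a) l i) *: F a = \sum_i l i *: F (q i).
Proof.
move=> qS; under eq_bigr do rewrite scaler_suml big_mkcond.
rewrite exchange_big /=; apply: eq_bigr => i _.
rewrite (big_fsetD1 (q i))//= eqxx big1_seq ?addr0// => b.
by rewrite !inE eq_sym => /andP[_ /andP[/negPf ->]].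
Qed.

Lemma sum_fibers1 S (k : nat) (l : 'I_k -> R) (q : 'I_k -> 'X_{1..n}) :
  (forall i, q i \in S) ->
  \sum_(a <- S) (\sum_(i | q i == a) l i) = \sum_i l i.
Proof.
move=> qS; have := sum_fibers l (fun _ => 1 : R^o) qS.
under eq_bigr do rewrite [_ *: _]mulr1; move=> ->.
by apply: eq_bigr => i _; rewrite [_ *: _]mulr1.
Qed.

Lemma enum_points S lam : exists (k : nat) (l : 'I_k -> R) (q : 'I_k -> 'X_{1..n}),
  [/\ forall i, l i = lam (q i), \sum_i l i = \sum_(a <- S) lam a,
      forall i, q i \in S & \sum_i l i *: pt (q i) = \sum_(a <- S) lam a *: pt a].
Proof.
pose s : seq _ := S; pose q i := tnth (in_tuple s) i.
exists (size s), (fun i => lam (q i)), q; split=> //.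
- by rewrite [RHS]big_tnth.
- by move=> i; exact: mem_tnth.
- by rewrite [RHS]big_tnth.
Qed.

Lemma conv_hullP S y : conv_hull (points S) y <-> exists lam,
  [/\ forall a, 0 <= lam a, forall a, a \notin S -> lam a = 0,
      \sum_(a <- S) lam a = 1 & y = \sum_(a <- S) lam a *: pt a].
Proof.
split=> [[k [l [p [l0 l1 pS ->]]]]|[lam [lam0 lamS lam1 ->]]].
  have /choice[q qP] : forall i, exists a, a \in S /\ pt a = p i.
    by move=> i; have [a] := pS i; exists a.
  exists (fun a => \sum_(i | q i == a) l i); split=> [a|a aS||].
  - exact: sumr_ge0.
  - by apply: big_pred0 => i; apply: contraNF aS => /eqP <-; case: (qP i).
  - by rewrite sum_fibers1// => i; case: (qP i).
  rewrite sum_fibers => [|i]; last by case: (qP i).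
  by apply: eq_bigr => i _; case: (qP i) => _ ->.
have [k [l [q [lE l1 qS lq]]]] := enum_points S lam.
exists k, l, (fun i => pt (q i)); split=> [i||i|//]; rewrite ?lE ?l1//.
by exists (q i) => //; exact: qS.
Qed.

Lemma aff_hullP S y : aff_hull (points S) y <-> exists lam,
  [/\ forall a, a \notin S -> lam a = 0,
      \sum_(a <- S) lam a = 1 & y = \sum_(a <- S) lam a *: pt a].
Proof.
split=> [[k [l [p [l1 pS ->]]]]|[lam [lamS lam1 ->]]].
  have /choice[q qP] : forall i, exists a, a \in S /\ pt a = p i.
    by move=> i; have [a] := pS i; exists a.
  exists (fun a => \sum_(i | q i == a) l i); split=> [a aS||].
  - by apply: big_pred0 => i; apply: contraNF aS => /eqP <-; case: (qP i).
  - by rewrite sum_fibers1// => i; case: (qP i).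
  rewrite sum_fibers => [|i]; last by case: (qP i).
  by apply: eq_bigr => i _; case: (qP i) => _ ->.
have [k [l [q [lE l1 qS lq]]]] := enum_points S lam.
exists k, l, (fun i => pt (q i)); split=> [|i|//]; rewrite ?l1//.
by exists (q i) => //; exact: qS.
Qed.

(** The relative interior is taken inside the affine hull of the convex hull,
    while barycentric coordinates describe the affine hull of the points. *)
Lemma aff_hull_conv S y :
  aff_hull (conv_hull (points S)) y <-> aff_hull (points S) y.
Proof.
split=> [[k [l [p [l1 pS ->]]]]|[k [l [p [l1 pS ->]]]]].
  have /choice[m mP] : forall i, exists lam, [/\ forall a, a \notin S -> lam a = 0,
      \sum_(a <- S) lam a = 1 & p i = \sum_(a <- S) lam a *: pt a].
    by move=> i; have /conv_hullP[lam []] := pS i; exists lam.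
  apply/aff_hullP; exists (fun a => \sum_i l i * m i a); split=> [a aS||].
  - by rewrite big1// => i _; have [->] := mP i; rewrite ?mulr0.
  - rewrite exchange_big/= -[RHS]l1; apply: eq_bigr => i _.
    by rewrite -mulr_sumr; have [_ ->] := mP i; rewrite mulr1.
  under [RHS]eq_bigr do rewrite scaler_suml.
  rewrite exchange_big/=; apply: eq_bigr => i _; have [_ _ ->] := mP i.
  by rewrite scaler_sumr; apply: eq_bigr => a _; rewrite scalerA.
exists k, l, p; split=> // i; exists 1%N, (fun=> 1), (fun=> p i).
by split=> //; rewrite big_ord1// scale1r.
Qed.

(** If the coefficient of some [a] in [S] were zero, then moving from [b] a
    little further away from [a] would stay in the affine hull but make this
    coordinate negative; hence a point of the relative interior has positive
    coefficients. *)
Lemma circuit_weights A S b : circuit R A S b -> exists lam,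
  [/\ weights A lam b, indep_support A lam & forall a, (a \in S) = (lam a != 0)].
Proof.
move=> [S0 SA evS indS [bA [/conv_hullP[lam [lam0 lamS lam1 lamb]] nearb]]].
have [c [u cu]] := dual_basis indS.
have coordE mu : \sum_(a <- S) mu a = 1 -> forall a, a \in S ->
    affine_form (c a) (u a) (\sum_(a <- S) mu a *: pt a) = mu a.
  move=> mu1 a aS; rewrite affine_form_sum// (big_fsetD1 a)//= big1_seq ?addr0.
    by rewrite cu// eqxx mulr1.
  move=> a'; rewrite !inE => /andP[_ /andP[a'a a'S]].
  by rewrite cu// eq_sym (negPf a'a) mulr0.
have SE a : (a \in S) = (lam a != 0).
  apply/idP/idP => [aS|]; last by apply: contraNT => /lamS/eqP.
  apply/eqP => lama0.
  have [t t0] := near_line (pt b - pt a) nearb.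
  have affy : aff_hull (points S) (pt b + t *: (pt b - pt a)).
    apply/aff_hullP; exists (fun a' => (1 + t) * lam a' - t * (a' == a)%:R).
    split=> [a' a'S||].
    - rewrite lamS//; have -> : (a' == a) = false.
        by apply: contraNF a'S => /eqP ->.
      by rewrite !mulr0 subr0.
    - by rewrite sumrB -!mulr_sumr lam1 sum_delta1// !mulr1 addrK.
    under eq_bigr do rewrite scalerBl -!scalerA.
    rewrite sumrB -!scaler_sumr -lamb sum_delta// scalerBr scalerDl scale1r.
    by rewrite addrA.
  move=> /(_ (iffRL (aff_hull_conv _ _) affy))/conv_hullP[mu [mu0 _ mu1 muy]].
  have := mu0 a; rewrite -(coordE mu mu1)// -muy affine_form_line lamb.
  by rewrite (coordE lam)// lama0 cu// eqxx add0r sub0r mulrN1 oppr_ge0 leNgt t0.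
have lamA a : lam a != 0 -> a \in A by rewrite -SE => /(fsubsetP SA).
have suppE : supp A lam = S by apply/fsetP => a; rewrite in_supp.
exists lam; split=> //.
- split=> // [a la||].
  + by rewrite lamA//= evS// SE.
  + by rewrite -(@sum_supp A lam)// suppE.
  + by rewrite -(@sum_supp A lam) ?suppE -?lamb// => a ->; rewrite scale0r.
- by apply/indep_supportP; rewrite ?suppE.
Qed.

(** Conversely the barycentric coordinates are continuous, so they remain
    positive on the affine hull near [b]. *)
Lemma weights_circuit A lam b :
  weights A lam b -> indep_support A lam -> b \in A -> circuit R A (supp A lam) b.
Proof.
move=> [lam0 lamA lam1 lamb] ind bA.
have {}lamAA a : lam a != 0 -> a \in A by move=> /lamA/andP[].
have lamev a : lam a != 0 -> even_mnm a by move=> /lamA/andP[].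
have SE a := in_supp a lamAA.
split=> //.
- apply/eqP => s0; move: lam1; rewrite -(@sum_supp A lam)// s0 big_seq_fset0.
  by move/eqP; rewrite eq_sym oner_eq0.
- by apply/fsubsetP => a; rewrite SE => /lamAA.
- by move=> a; rewrite SE => /lamev.
- exact/indep_supportP.
split=> //; split.
  apply/conv_hullP; exists lam; split=> //.
  - by move=> a; rewrite SE negbK => /eqP.
  - by rewrite sum_supp.
  - by rewrite sum_supp// => a ->; rewrite scale0r.
have [c [u cu]] := bary_coords_exist lamAA ind.
have pos a : a \in supp A lam -> 0 < affine_form (c a) (u a) (pt b).
  by rewrite SE => la; rewrite -lamb (bary_coordsE lamAA cu)// lt0r la lam0.
have := near_all_in (fun a aS => near_affine_form_gt0 (pos a aS)).
apply: filterS => y ypos /aff_hull_conv/aff_hullP[mu [muS mu1 yE]].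
apply/conv_hullP; exists mu; split=> // a.
have [aS|/muS -> //] := boolP (a \in supp A lam).
have {}ypos := ypos a aS; apply: ltW; move: ypos.
have mu0 a' : lam a' = 0 -> mu a' = 0.
  by move=> la; apply: muS; rewrite SE la eqxx.
rewrite yE sum_supp ?(bary_coordsE lamAA cu)// -?(@sum_supp A lam)//.
by move=> a' /mu0 ->; rewrite scale0r.
Qed.

End Weights.

(** * The weighted arithmetic-geometric mean inequality *)

Section ArithmeticGeometric.
Variables (R : realType) (n : nat).
Local Notation pt := (@Defs.point R n).
Implicit Types (A S : {fset 'X_{1..n}}) (a b : 'X_{1..n}).
Implicit Types (lam mu h t : 'X_{1..n} -> R) (f g : {mpoly R[n]}).

(** The graph of the exponential lies above its tangent at the mean [m],
    strictly away from [m]; summing the tangent inequalities with weights [lam]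
    gives both the inequality and its equality case. *)
Lemma jensen_expR A lam t : (forall a, 0 <= lam a) -> \sum_(a <- A) lam a = 1 ->
  let m := \sum_(a <- A) lam a * t a in
  expR m <= \sum_(a <- A) lam a * expR (t a)
  ?= iff all (fun a => (lam a == 0) || (t a == m)) A.
Proof.
move=> lam0 lam1 m.
pose gap a := lam a * (expR (t a) - expR m * (1 + (t a - m))).
have gap0 a : 0 <= gap a.
  rewrite mulr_ge0// subr_ge0 -[leRHS](_ : expR (m + (t a - m)) = _).
    by rewrite expRD ler_pM2l ?expR_gt0// expR_ge1Dx.
  by congr expR; ring.
have gapE a : (gap a == 0) = (lam a == 0) || (t a == m).
  rewrite /gap mulf_eq0; congr orb; apply/idP/idP => [|/eqP ->]; last first.
    by rewrite subrr addr0 mulr1 subrr.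
  apply: contraTT; rewrite -subr_eq0 => /expR_gt1Dx lt1.
  rewrite gt_eqF// subr_gt0 -[ltRHS](_ : expR (m + (t a - m)) = _).
    by rewrite expRD ltr_pM2l ?expR_gt0.
  by congr expR; ring.
have sumE : \sum_(a <- A) lam a * expR (t a) - expR m = \sum_(a <- A) gap a.
  under [RHS]eq_bigr do rewrite /gap mulrBr.
  rewrite sumrB; congr (_ - _).
  under eq_bigr => a _.
    have -> : lam a * (expR m * (1 + (t a - m)))
      = expR m * (1 - m) * lam a + expR m * (lam a * t a) by ring.
  over.
  rewrite big_split/= -!mulr_sumr lam1 -/m; ring.
split; first by rewrite -subr_ge0 sumE sumr_ge0.
rewrite eq_sym -subr_eq0 sumE psumr_eq0//.
by apply: eq_all => a; rewrite gapE.
Qed.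

(** A circuit [(S, b)] with [b] outside [S]; the degenerate circuits only
    give monomials. *)
Definition amgm_circuit A lam b : Prop :=
  [/\ weights A lam b, indep_support A lam, b \in A & lam b = 0].

(** Writing the coefficients as [c a = lam a * exp (h a)] makes the circuit
    number [\prod_a (c a / lam a) ^ lam a] equal to [exp (\sum_a lam a * h a)];
    for the signs [s] of [amgm_sign] the polynomial is then on the boundary of
    the nonnegative circuit polynomials. *)
Definition amgm_poly A lam h (s : R) b : {mpoly R[n]} :=
  \sum_(a <- A) (lam a * expR (h a)) *: 'X_[a]
  + (s * expR (\sum_(a <- A) lam a * h a)) *: 'X_[b].

(** The signs for which the last term of [amgm_poly] is negative at some
    point with nonzero coordinates. *)
Definition amgm_sign (s : R) b : Prop := s = -1 \/ s = 1 /\ ~~ even_mnm b.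

Definition sonc_generator A g : Prop :=
  (exists a, [/\ a \in A, even_mnm a & g = 'X_[a]])
  \/ exists lam h s b,
      [/\ amgm_circuit A lam b, amgm_sign s b & g = amgm_poly A lam h s b].

Lemma even_mevalX_ge0 a (x : 'I_n -> R) : even_mnm a -> 0 <= ('X_[a]).@[x].
Proof.
move=> /forallP ev; rewrite mevalX prodr_ge0// => i _.
by rewrite exprn_even_ge0// ev.
Qed.

Lemma mevalX_sign_exp a (e : 'I_n -> R) (w : 'cV[R]_n) :
  ('X_[a]).@[fun i => e i * expR (w i 0)]
  = (\prod_i e i ^+ a i) * expR ((pt a *m w) 0 0).
Proof.
rewrite mevalX !mxE expR_sum -big_split/=; apply: eq_bigr => i _.
by rewrite exprMn -expRM_natl mxE.
Qed.

Lemma norm_mevalX a (x : 'I_n -> R) : (forall i, x i = 0 -> a i = 0%N) ->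
  `|('X_[a]).@[x]| = expR ((pt a *m \col_i ln `|x i|) 0 0).
Proof.
move=> xa; rewrite mevalX normr_prod !mxE expR_sum; apply: eq_bigr => i _.
rewrite !mxE expRM_natl normrX; have [x0|x0] := eqVneq (x i) 0.
  by rewrite xa// !expr0.
by rewrite lnK// posrE normr_gt0.
Qed.

Lemma weights_point A lam b (w : 'cV[R]_n) : weights A lam b ->
  \sum_(a <- A) lam a * (pt a *m w) 0 0 = (pt b *m w) 0 0.
Proof.
move=> [_ _ _ <-]; rewrite mulmx_suml summxE; apply: eq_bigr => a _.
by rewrite -scalemxAl [RHS]mxE.
Qed.

(** If [b] does not involve a variable, neither do the exponents of which
    [b] is a convex combination with positive weights, as exponents are
    nonnegative. *)
Lemma weights_coord0 A lam b i a : weights A lam b ->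
  b i = 0%N -> lam a != 0 -> a i = 0%N.
Proof.
move=> [lam0 lamA lam1 lamb] bi la.
have := congr1 (fun y : 'rV[R]_n => y 0 i) lamb.
rewrite summxE mxE bi => /eqP; rewrite psumr_eq0 => [/allP/(_ a)|a' _]; last first.
  by rewrite !mxE mulr_ge0// ler0n.
have /andP[aA _] := lamA _ la.
by rewrite aA !mxE mulf_eq0 (negPf la) pnatr_eq0/= => /(_ isT)/eqP.
Qed.

Lemma meval_sum (I : Type) (r : seq I) (F : I -> {mpoly R[n]}) (x : 'I_n -> R) :
  (\sum_(i <- r) F i).@[x] = \sum_(i <- r) (F i).@[x].
Proof. exact: (big_morph _ (mevalD x) (meval0 x)). Qed.

(** Where the monomial [b] does not vanish, put [|x i| = exp (w i)]: all
    monomials become exponentials of linear forms in [w], and the claim is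
    Jensen's inequality. *)
Lemma amgm_nonneg A lam h s b : weights A lam b -> `|s| <= 1 ->
  nonneg_poly (amgm_poly A lam h s b).
Proof.
move=> lamb s1 x; have [lam0 lamA lam1 _] := lamb.
rewrite /amgm_poly mevalD meval_sum mevalZ.
under eq_bigr do rewrite mevalZ.
have term0 a : 0 <= lam a * expR (h a) * ('X_[a]).@[x].
  have [->|la] := eqVneq (lam a) 0; first by rewrite !mul0r.
  have /andP[_ ev] := lamA _ la.
  by rewrite !mulr_ge0// ?expR_ge0// even_mevalX_ge0.
have [->|xb] := eqVneq (('X_[b]).@[x] : R) 0; first by rewrite mulr0 addr0 sumr_ge0.
have xb0 i : x i = 0 -> b i = 0%N.
  move=> xi; apply/eqP; apply: contraNT xb => bi.
  by rewrite mevalX (bigD1 i)//= xi expr0n (negPf bi) mul0r.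
(* Coordinates with x i = 0 do not occur in the remaining monomials, so the
   value of ln at 0 is irrelevant. *)
pose w : 'cV[R]_n := \col_i ln `|x i|.
have {term0} : \sum_(a <- A) lam a * expR (h a + (pt a *m w) 0 0)
    <= \sum_(a <- A) lam a * expR (h a) * ('X_[a]).@[x].
  apply: ler_sum => a _.
  have [->|la] := eqVneq (lam a) 0; first by rewrite !mul0r.
  have /andP[_ ev] := lamA _ la.
  rewrite expRD mulrA ler_wpM2l ?mulr_ge0 ?expR_ge0// -norm_mevalX.
    by rewrite ger0_norm// even_mevalX_ge0.
  by move=> i /xb0 bi; apply: weights_coord0 lamb bi la.
have [+ _] := jensen_expR (fun a => h a + (pt a *m w) 0 0) lam0 lam1.
move=> /le_trans le1 /le1.
rewrite (eq_bigr (fun a => lam a * h a + lam a * (pt a *m w) 0 0)); last first.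
  by move=> a _; rewrite mulrDr.
rewrite big_split/= (weights_point _ lamb) expRD -(norm_mevalX xb0).
set E := expR _; set N := _.@[x]; rewrite -subr_ge0 => /le_trans; apply.
rewrite lerD2l lerNl (le_trans (ler_norm _))// normrN.
rewrite !normrM ler_wpM2r// (ger0_norm (expR_ge0 _)).
by rewrite ler_piMl// expR_ge0.
Qed.

Lemma affine_interpolation A lam h : (forall a, lam a != 0 -> a \in A) ->
  indep_support A lam -> exists w0 w, forall a, lam a != 0 -> affine_form w0 w (pt a) = h a.
Proof.
move=> lamA /(bary_coords_exist lamA)[c [u [cu _]]].
exists (\sum_(a <- A) h a * c a), (\sum_(a <- A) h a *: u a) => a la.
transitivity (\sum_(a' <- A) h a' * affine_form (c a') (u a') (pt a)).
  rewrite /affine_form mulmx_sumr summxE -big_split/=; apply: eq_bigr => a' _.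
  by rewrite -scalemxAr mxE mulrDr.
rewrite (big_fsetD1 a)/= ?lamA// cu// eqxx mulr1 big1_seq ?addr0// => a'.
by rewrite !inE => /andP[_ /andP[/negPf a'a _]]; rewrite cu// a'a mulr0.
Qed.

(** By affine independence some positive point makes all terms of the
    arithmetic mean proportional to [lam]; there the AM-GM inequality is an
    equality, and nonnegativity at this point, with the sign of one coordinate
    flipped if [d > 0], is the bound on [d]. *)
Lemma circuit_number_bound A lam h d b : weights A lam b -> indep_support A lam ->
  d <= 0 \/ ~~ even_mnm b ->
  nonneg_poly (\sum_(a <- A) (lam a * expR (h a)) *: 'X_[a] + d *: 'X_[b]) ->
  `|d| <= expR (\sum_(a <- A) lam a * h a).
Proof.
move=> lamb ind dsgn fge0; have [lam0 lamA lam1 _] := lamb.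
have lamAA a : lam a != 0 -> a \in A by move=> /lamA/andP[].
have [w0 [w wh]] := affine_interpolation (fun a => - h a) lamAA ind.
(* A choice of signs of the coordinates that makes the term d * x^b nonpositive. *)
have [e [e1 eb]] : exists e : 'I_n -> R,
    (forall i, e i ^+ 2 = 1) /\ d * \prod_i e i ^+ b i = - `|d|.
  have pos : d <= 0 -> exists e : 'I_n -> R,
    (forall i, e i ^+ 2 = 1) /\ d * \prod_i e i ^+ b i = - `|d|.
    move=> d0; exists (fun=> 1); split=> [i|]; first by rewrite expr1n.
    by rewrite big1 => [|i _]; rewrite ?expr1n// mulr1 ler0_norm ?opprK.
  have [/pos //|d0] := leP d 0.
  case: dsgn => [/pos //|]; rewrite negb_forall => /existsP[i0]; rewrite negbK => oddi.
  exists (fun i => if i == i0 then -1 else 1); split=> [i|].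
    by case: ifP => _; rewrite ?sqrrN expr1n.
  rewrite (bigD1 i0)//= eqxx big1 => [|i /negPf ->]; last by rewrite expr1n.
  by rewrite -signr_odd oddi expr1 mulr1 mulrN1 gtr0_norm.
have := fge0 (fun i => e i * expR (w i 0)).
rewrite mevalD meval_sum mevalZ mevalX_sign_exp mulrA eb.
rewrite (eq_bigr (fun a => expR (- w0) * lam a)) => [|a _].
  rewrite -mulr_sumr lam1 mulr1 mulNr subr_ge0.
  have -> : (pt b *m w) 0 0 = - (\sum_(a <- A) lam a * h a) - w0.
    apply/eqP; rewrite -subr_eq opprK addrC -/(affine_form w0 w (pt b)).
    have [_ _ _ <-] := lamb; rewrite affine_form_sum// -sumrN; apply/eqP.
    apply: eq_bigr => a _; have [->|la] := eqVneq (lam a) 0.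
      by rewrite !mul0r oppr0.
    by rewrite wh// mulrN.
  by rewrite expRD mulrA expRN ger_pMl ?expR_gt0// ler_pdivrMr ?mul1r ?expR_gt0.
rewrite mevalZ mevalX_sign_exp.
have [->|la] := eqVneq (lam a) 0; first by rewrite !mul0r mulr0.
have /andP[_ /forallP ev] := lamA _ la.
rewrite big1 => [|i _].
  have := wh _ la; rewrite /affine_form => haE.
  have -> : h a = - w0 - (pt a *m w) 0 0 by lra.
  by rewrite mul1r -mulrA -expRD subrK mulrC.
rewrite -(odd_double_half (a i)) (negPf (ev i)) add0n -mul2n exprM e1.
by rewrite expr1n.
Qed.
End ArithmeticGeometric.

(** * Generators of the SONC cone *)

Section SoncGenerators.
Variables (R : realType) (n : nat).
Local Notation pt := (@Defs.point R n).
Implicit Types (A S : {fset 'X_{1..n}}) (a b : 'X_{1..n}).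
Implicit Types (lam mu h c : 'X_{1..n} -> R) (f g : {mpoly R[n]}).

Lemma mcoeff_sumX A c m : (forall a, a \notin A -> c a = 0) ->
  (\sum_(a <- A) c a *: 'X_[a] : {mpoly R[n]})@_m = c m.
Proof.
move=> cA; rewrite (big_morph _ (mcoeffD m) (mcoeff0 _ m)).
under eq_bigr do rewrite mcoeffZ mcoeffX.
have [mA|mA] := boolP (m \in A); last first.
  rewrite cA// big1_seq// => a /andP[_ aA]; case: eqP => [am|]; last by rewrite mulr0.
  by rewrite am (negPf mA) in aA.
rewrite (big_fsetD1 m)//= eqxx mulr1 big1_seq ?addr0// => a.
by rewrite !inE => /andP[_ /andP[/negPf -> _]]; rewrite mulr0.
Qed.

Lemma mcoeff_amgm A lam h s b m : (forall a, lam a != 0 -> a \in A) ->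
  (amgm_poly A lam h s b)@_m
  = lam m * expR (h m) + s * expR (\sum_(a <- A) lam a * h a) * (b == m)%:R.
Proof.
move=> lamA; rewrite /amgm_poly mcoeffD mcoeffZ mcoeffX mcoeff_sumX// => a.
by apply: contraNeq => /[!mulf_eq0]/norP[/lamA].
Qed.

(** Barycentric coordinates are unique, and those of a vertex are 0 and 1. *)
Lemma vertex_weights A lam b : weights A lam b -> indep_support A lam -> lam b != 0 ->
  forall a, lam a = (a == b)%:R.
Proof.
move=> [lam0 lamA lam1 lamb] ind lb a.
have lamAA a' : lam a' != 0 -> a' \in A by move=> /lamA/andP[].
have [c [u cu]] := bary_coords_exist lamAA ind.
by rewrite -(bary_coordsE lamAA cu)// lamb; case: cu => ->.
Qed.

Lemma weights_unique A lam mu b : weights A lam b -> indep_support A lam ->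
  weights A mu b -> (forall a, lam a = 0 -> mu a = 0) -> mu =1 lam.
Proof.
move=> [lam0 lamA lam1 lamb] ind [_ _ mu1 mub] sub a.
have lamAA a' : lam a' != 0 -> a' \in A by move=> /lamA/andP[].
have [c [u cu]] := bary_coords_exist lamAA ind.
by rewrite -[RHS](bary_coordsE lamAA cu)// lamb -mub (bary_coordsE lamAA cu).
Qed.

Lemma sonc0 A : sonc A (0 : {mpoly R[n]}).
Proof.
by exists 0%N, (fun=> 0), (fun=> 0); split=> [//|[]//|]; rewrite big_ord0.
Qed.

Lemma soncD A f g : sonc A f -> sonc A g -> sonc A (f + g).
Proof.
move=> [k [l [p [l0 pC ->]]]] [k' [l' [p' [l'0 p'C ->]]]].
exists (k + k')%N, (fun i => match split i with inl i => l i | inr i => l' i end),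
  (fun i => match split i with inl i => p i | inr i => p' i end).
split=> [i|i|]; try by case: split.
rewrite big_split_ord/=; congr (_ + _); apply: eq_bigr => i _.
  by rewrite -[lshift _ i]/(unsplit (inl i)) unsplitK.
by rewrite -[rshift _ i]/(unsplit (inr i)) unsplitK.
Qed.

Lemma soncZ A t f : 0 <= t -> sonc A f -> sonc A (t *: f).
Proof.
move=> t0 [k [l [p [l0 pC ->]]]]; exists k, (fun i => t * l i), p.
split=> // [i|]; first by rewrite mulr_ge0.
by rewrite scaler_sumr; apply: eq_bigr => i _; rewrite scalerA.
Qed.

Lemma sonc_circuit_poly A f : circuit_poly A f -> nonneg_poly f -> sonc A f.
Proof.
move=> fA f0; exists 1%N, (fun=> 1), (fun=> f); split=> //.
by rewrite big_ord1 scale1r.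
Qed.

Lemma amgm_sonc A lam h s b : weights A lam b -> indep_support A lam -> b \in A ->
  `|s| <= 1 -> sonc A (amgm_poly A lam h s b).
Proof.
move=> wlam ind bA s1; apply: sonc_circuit_poly; last exact: amgm_nonneg.
left; have [lam0 lamA _ _] := wlam.
have lamAA a' : lam a' != 0 -> a' \in A by move=> /lamA/andP[].
exists (supp A lam), b, (fun a => lam a * expR (h a)),
  (s * expR (\sum_(a <- A) lam a * h a)); split.
- exact: weights_circuit.
- by move=> a; rewrite in_supp// => la; rewrite mulr_gt0 ?expR_gt0// lt0r la lam0.
by rewrite sum_supp// => a ->; rewrite mul0r scale0r.
Qed.

Lemma monomial_sonc A a : a \in A -> even_mnm a -> sonc A ('X_[a] : {mpoly R[n]}).
Proof.
move=> aA ev; apply: sonc_circuit_poly; last by move=> x; exact: even_mevalX_ge0.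
right; exists (fun b => (b == a)%:R); split=> [b|]; first exact: ler0n.
rewrite big_mkcond (big_fsetD1 a)//= ev eqxx scale1r big1_seq ?addr0// => b.
by rewrite !inE => /andP[_ /andP[/negPf -> _]]; rewrite scale0r if_same.
Qed.

Lemma amgm_sign_norm (s : R) b : amgm_sign s b -> `|s| = 1.
Proof. by case=> [->|[-> _]]; rewrite ?normrN normr1. Qed.

Lemma generator_sonc A g : sonc_generator A g -> sonc A g.
Proof.
case=> [[a [aA ev ->]]|[lam [h [s [b [[wlam ind bA _] /amgm_sign_norm s1 ->]]]]]].
  exact: monomial_sonc.
by apply: amgm_sonc; rewrite ?s1.
Qed.

(** Below the circuit number, a circuit polynomial is a convex combination of
    an AM-GM polynomial and a positive combination of even monomials; so even
    monomials and AM-GM polynomials with admissible sign generate the cone. *)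
Lemma sonc_ind A (C : {mpoly R[n]} -> Prop) :
  C 0 -> (forall f g, C f -> C g -> C (f + g)) ->
  (forall t f, 0 <= t -> C f -> C (t *: f)) ->
  (forall g, sonc_generator A g -> C g) ->
  forall f, sonc A f -> C f.
Proof.
move=> C0 CD CZ Cg f [k [l [p [l0 pC ->]]]].
apply: (big_ind C) => // i _; apply: (CZ) => //; have := pC i.
move: (p i) => {f k l p l0 pC i} f [fC f0].
have CX c : (forall a, c a != 0 -> (0 <= c a) && even_mnm a) ->
    C (\sum_(a <- A) c a *: 'X_[a]).
  move=> cP; rewrite big_seq; apply: (big_ind C) => // a aA.
  have [->|ca] := eqVneq (c a) 0; first by rewrite scale0r.
  have /andP[ca0 ev] := cP _ ca.
  by apply: CZ => //; apply: Cg; left; exists a.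
case: fC => [[S [b [c [d [circ c0 fE]]]]]|[c [c0 ->]]]; last first.
  rewrite big_seq_cond.
  apply: (big_ind C) => // a /andP[aA ev]; apply: CZ => //.
  by apply: Cg; left; exists a.
have [lam [wlam ind lamS]] := circuit_weights circ.
have bA : b \in A by case: circ => _ _ _ _ [].
have [lam0 lamA lam1 lamb] := wlam.
have lamAA a' : lam a' != 0 -> a' \in A by move=> /lamA/andP[].
pose h a := ln (c a / lam a).
have hE a : a \in S -> lam a * expR (h a) = c a.
  move=> aS; have la : lam a != 0 by rewrite -lamS.
  rewrite /h lnK; first by rewrite mulrCA divff// mulr1.
  by rewrite posrE divr_gt0 ?c0// lt0r la lam0.
have {fE} fE : f = \sum_(a <- A) (lam a * expR (h a)) *: 'X_[a] + d *: 'X_[b].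
  rewrite fE; congr (_ + _).
  rewrite -(@sum_supp _ _ A lam) => [|a ->]; last by rewrite mul0r scale0r.
  have -> : supp A lam = S by apply/fsetP => a; rewrite in_supp// lamS.
  by apply: eq_big_seq => a aS; rewrite hE.
have Csum : C (\sum_(a <- A) (lam a * expR (h a)) *: 'X_[a]).
  apply: CX => a; rewrite mulf_eq0 expR_eq0 orbF => /lamA/andP[_ ->].
  by rewrite mulr_ge0 ?expR_ge0.
have [lb|lb] := eqVneq (lam b) 0; last first.
  have lamE := vertex_weights wlam ind lb.
  have fE' : f = (expR (h b) + d) *: 'X_[b].
    rewrite fE (big_fsetD1 b)//= lamE eqxx mul1r big1_seq ?addr0 ?scalerDl// => a.
    by rewrite !inE lamE => /andP[_ /andP[/negPf -> _]]; rewrite mul0r scale0r.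
  rewrite fE'; apply: CZ; last first.
    by apply: Cg; left; exists b; split=> //; have /andP[] := lamA _ lb.
  have := f0 (fun=> 1); rewrite fE' mevalZ mevalX big1 ?mulr1// => j _.
  by rewrite expr1n.
have [evd|] := boolP ((0 <= d) && even_mnm b).
  have /andP[d0 ev] := evd; rewrite fE; apply: CD => //; apply: CZ => //.
  by apply: Cg; left; exists b.
rewrite negb_and -ltNge => dP.
pose T := expR (\sum_(a <- A) lam a * h a).
have T0 : 0 < T by exact: expR_gt0.
have dT : `|d| <= T.
  apply: circuit_number_bound wlam ind _ _; last by rewrite -fE.
  by case/orP: dP => [/ltW|]; [left|right].
have [s [ssgn sd]] : exists s : R, amgm_sign s b /\ s * `|d| = d.
  have [d0|d0] := ltP d 0.
    by exists (-1); split; [left|rewrite ltr0_norm// mulN1r opprK].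
  exists 1; split; last by rewrite ger0_norm// mul1r.
  by right; split=> //; move: dP; rewrite ltNge d0.
(* The AM-GM polynomial is scaled so that it carries the whole term d * x^b. *)
have -> : f = (`|d| / T) *: amgm_poly A lam h s b
    + (1 - `|d| / T) *: \sum_(a <- A) (lam a * expR (h a)) *: 'X_[a].
  rewrite fE /amgm_poly -/T scalerDr addrAC -scalerDl subrKC scale1r scalerA.
  by congr (_ + _ *: _); rewrite mulrCA divfK ?gt_eqF.
apply: CD; apply: CZ => //.
- by rewrite divr_ge0// ltW.
- by apply: Cg; right; exists lam, h, s, b.
- by rewrite subr_ge0 ler_pdivrMr// mul1r.
Qed.

End SoncGenerators.

(** * Extreme rays, exposing forms and monomials *)

Section ExposedRays.
Variables (R : realType) (n : nat).
Local Notation pt := (@Defs.point R n).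
Implicit Types (A S : {fset 'X_{1..n}}) (a b : 'X_{1..n}).
Implicit Types (lam mu h c v : 'X_{1..n} -> R) (f g : {mpoly R[n]}).

(** In a decomposition of a vector of the ray into generators, extremality
    puts every term on the ray, and some term is nonzero. *)
Lemma extreme_ray_generator A r : extreme_ray (sonc A) r ->
  exists g, [/\ sonc_generator A g, r = ray g
    & forall y z, g = y + z -> sonc A y -> sonc A z -> ray g y].
Proof.
move=> [v [v0 -> rK ext]].
pose C f := ray v f -> f != 0 -> exists g, [/\ sonc_generator A g, ray v g & g != 0].
have [_] : sonc A v /\ C v.
  have : sonc A v by apply: rK; exists 1 => //; rewrite scale1r.
  apply: (@sonc_ind _ _ _ (fun f => sonc A f /\ C f)).
  - by split; [exact: sonc0|move=> _; rewrite eqxx].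
  - move=> f g [fK Cf] [gK Cg]; split; first exact: soncD.
    move=> rfg fg0; have [rf rg] := ext _ _ _ rfg erefl fK gK.
    have [f0|] := eqVneq f 0; last by move/(Cf rf).
    by apply: Cg => //; rewrite f0 add0r in fg0.
  - move=> t f t0 [fK Cf]; split; first exact: soncZ.
    move=> [k k0 tf]; rewrite scaler_eq0 negb_or => /andP[tn0 fn0].
    apply: Cf => //; exists (t^-1 * k); first by rewrite mulr_ge0// invr_ge0.
    by rewrite -scalerA -tf scalerA mulVf// scale1r.
  - by move=> g gA; split; [exact: generator_sonc|exists g].
have vv : ray v v by exists 1 => //; rewrite scale1r.
move=> /(_ vv v0)[g [gA [k k0 gE] g0]].
have k1 : 0 < k.
  by rewrite lt0r k0 andbT; apply: contraNneq g0 => kk; rewrite gE kk scale0r.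
have rE : ray v = ray g.
  apply/seteqP; split=> x [t t0 ->].
    exists (t / k); first by rewrite divr_ge0.
    by rewrite gE scalerA divfK ?gt_eqF.
  by exists (t * k); rewrite ?mulr_ge0// gE scalerA.
exists g; split=> // y z gyz yK zK.
by have [] := ext g y z _ gyz yK zK; rewrite -?rE; [exists k|].
Qed.

(** The linear form sending the monomial [a] to [v a]; point evaluations and
    all perturbations of them used below have this shape. *)
Definition coef_form A v f : R := \sum_(a <- A) f@_a * v a.

Lemma coef_formD A v f g : coef_form A v (f + g) = coef_form A v f + coef_form A v g.
Proof. by rewrite /coef_form -big_split/=; apply: eq_bigr => a _; rewrite mcoeffD mulrDl. Qed.

Lemma coef_formZ A v t f : coef_form A v (t *: f) = t * coef_form A v f.
Proof. by rewrite /coef_form mulr_sumr; apply: eq_bigr => a _; rewrite mcoeffZ mulrA. Qed.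

Lemma coef_formX A v a : a \in A -> coef_form A v 'X_[a] = v a.
Proof.
move=> aA; rewrite /coef_form (big_fsetD1 a)//= mcoeffX eqxx mul1r big1_seq ?addr0// => b.
by rewrite !inE mcoeffX eq_sym => /andP[_ /andP[/negPf -> _]]; rewrite mul0r.
Qed.

Lemma coef_form_amgm A v lam h s b : (forall a, lam a != 0 -> a \in A) -> b \in A ->
  coef_form A v (amgm_poly A lam h s b)
  = \sum_(a <- A) lam a * expR (h a) * v a
    + s * expR (\sum_(a <- A) lam a * h a) * v b.
Proof.
move=> lamA bA; rewrite /amgm_poly coef_formD coef_formZ coef_formX//; congr (_ + _).
apply: eq_bigr => a _; rewrite mcoeff_sumX// => a'.
by apply: contraNeq => /[!mulf_eq0]/norP[/lamA].
Qed.

(** A linear form exposes a ray as soon as it does so among the generators. *)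
Lemma exposed_ray A v g : coef_form A v g = 0 ->
  (forall q, sonc_generator A q ->
    0 <= coef_form A v q /\ (coef_form A v q = 0 -> ray g q)) ->
  exposed (polys_on A) (sonc A) (ray g).
Proof.
move=> vg vgen; exists (coef_form A v); split=> [t x y _ _|x [t _ ->]|y [yK ry]].
- by rewrite coef_formD coef_formZ.
- by rewrite coef_formZ vg mulr0.
suff [y0 yr] : 0 <= coef_form A v y /\ (coef_form A v y = 0 -> ray g y).
  by rewrite lt0r y0 andbT; apply/eqP => /yr.
move: y yK {ry}; apply: sonc_ind => //.
- rewrite -(scale0r g) coef_formZ mul0r; split=> // _.
  by exists 0.
- move=> f1 f2 [f10 r1] [f20 r2]; rewrite coef_formD; split; first exact: addr_ge0.
  move=> /eqP; rewrite paddr_eq0// => /andP[/eqP/r1[t1 t10 ->] /eqP/r2[t2 t20 ->]].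
  by exists (t1 + t2); rewrite ?addr_ge0// scalerDl.
move=> t f t0 [f0 rf]; rewrite coef_formZ; split; first exact: mulr_ge0.
move/eqP; rewrite mulf_eq0 => /predU1P[->|/eqP/rf[k k0 ->]].
  by exists 0 => //; rewrite !scale0r.
by exists (t * k); rewrite ?mulr_ge0// scalerA.
Qed.

(** If [v = exp L] on the support of the circuit, the arithmetic mean part of
    the value is bounded below by Jensen's inequality. The value is therefore
    positive as soon as [log |v b|] lies strictly below the interpolation of
    [L] at [b]. *)
Lemma coef_form_amgm_ge A v lam (L : 'X_{1..n} -> R) h s b :
  weights A lam b -> b \in A -> `|s| = 1 ->
  (forall a, lam a != 0 -> v a = expR (L a)) ->
  expR (\sum_(a <- A) lam a * h a) * (expR (\sum_(a <- A) lam a * L a) - `|v b|)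
  <= coef_form A v (amgm_poly A lam h s b).
Proof.
move=> [lam0 lamA lam1 _] bA s1 vL.
rewrite coef_form_amgm// => [|a /lamA/andP[]//].
have [+ _] := jensen_expR (fun a => h a + L a) lam0 lam1.
have -> : \sum_(a <- A) lam a * (h a + L a)
    = \sum_(a <- A) lam a * h a + \sum_(a <- A) lam a * L a.
  by rewrite -big_split; apply: eq_bigr => a _; rewrite mulrDr.
have -> : \sum_(a <- A) lam a * expR (h a + L a) = \sum_(a <- A) lam a * expR (h a) * v a.
  apply: eq_bigr => a _; have [->|la] := eqVneq (lam a) 0; first by rewrite !mul0r.
  by rewrite vL// expRD mulrA.
rewrite expRD mulrBr => le1; apply: lerD => //.
rewrite lerNl (le_trans (ler_norm _))// normrN !normrM s1 mul1r.
by rewrite ger0_norm ?expR_ge0.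
Qed.

Lemma weights_neq0 A lam b : weights A lam b -> exists a, lam a != 0.
Proof.
move=> [_ _ lam1 _]; apply/not_existsP => lam0.
move: lam1; rewrite big1 => [/eqP|a _]; first by rewrite eq_sym oner_eq0.
by apply/eqP; apply: contra_notT (lam0 a) => ->.
Qed.

Definition sqnorm a : R := \sum_i (a i)%:R ^+ 2.

(** The difference of the two sides is the variance
    [\sum_a lam a * |a - b|^2]. *)
Lemma sqnorm_strict_convex A lam b : weights A lam b -> lam b = 0 ->
  sqnorm b < \sum_(a <- A) lam a * sqnorm a.
Proof.
move=> wlam lb; have [lam0 lamA lam1 _] := wlam.
rewrite -subr_gt0.
have inner := weights_point (pt b)^T wlam.
have -> : \sum_(a <- A) lam a * sqnorm a - sqnorm b
    = \sum_(a <- A) lam a * \sum_i ((a i)%:R - (b i)%:R) ^+ 2.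
  under [RHS]eq_bigr => a _.
    have -> : \sum_i ((a i)%:R - (b i)%:R) ^+ 2
        = sqnorm a - 2 * (pt a *m (pt b)^T) 0 0 + (pt b *m (pt b)^T) 0 0.
      rewrite !mxE mulr_sumr -sumrB -big_split/=; apply: eq_bigr => i _.
      by rewrite !mxE; ring.
    rewrite mulrDr mulrBr mulrCA.
  over.
  rewrite big_split/= sumrB -mulr_sumr inner -mulr_suml lam1 mul1r.
  have -> : (pt b *m (pt b)^T) 0 0 = sqnorm b.
    by rewrite !mxE; apply: eq_bigr => i _; rewrite !mxE expr2.
  ring.
have [a la] := weights_neq0 wlam.
have /andP[aA _] := lamA _ la.
rewrite (big_fsetD1 a)//= ltr_pwDl//; last first.
  by apply: sumr_ge0 => a' _; rewrite mulr_ge0// sumr_ge0// => i _; exact: sqr_ge0.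
rewrite mulr_gt0// ?lt0r ?la ?lam0//.
have /eqP : a != b by apply: contraNneq la => ->; rewrite lb.
rewrite sumr_ge0 ?andbT => [|i _]; last exact: sqr_ge0.
move=> ab; rewrite psumr_eq0 => [|i _]; last exact: sqr_ge0.
apply/negP => /allP eqab; apply: ab; apply/mnmP => i.
have := eqab i (mem_index_enum _); rewrite sqrf_eq0 subr_eq0 eqr_nat.
by move/eqP.
Qed.

(** The form sends [a] and the odd monomials to zero, and every other even
    monomial [c] to [exp |c|^2]. A circuit that has [a] in its support has an odd
    inner point, so that only its positive terms contribute. The same holds for
    circuits with inner point [a]. On the circuits with another even inner point
    the form is positive because [|c|^2] is strictly convex. *)
Lemma monomial_exposed A a : a \in A -> even_mnm a ->
  (forall lam b, amgm_circuit A lam b -> lam a != 0 -> ~~ even_mnm b) ->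
  exposed (polys_on A) (sonc A) (ray ('X_[a] : {mpoly R[n]})).
Proof.
move=> aA eva nocirc.
pose v b := if (b == a) || ~~ even_mnm b then 0 else expR (sqnorm b).
have v0 b : 0 <= v b by rewrite /v; case: ifP => // _; exact: expR_ge0.
apply: (@exposed_ray A v); first by rewrite coef_formX// /v eqxx.
move=> q [[b [bA evb ->]]|[lam [h [s [b [[wlam ind bA lb] sb ->]]]]]].
  rewrite coef_formX//; split=> //; rewrite /v evb orbF; case: (eqVneq b a) => [-> _|_ /eqP].
    by exists 1; rewrite ?scale1r.
  by rewrite expR_eq0.
suff lt0 : 0 < coef_form A v (amgm_poly A lam h s b).
  by split=> [|l0]; [exact: ltW|move: lt0; rewrite l0 ltxx].
have [lam0 lamA lam1 lamb] := wlam.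
have lamAA a' : lam a' != 0 -> a' \in A by move=> /lamA/andP[].
(* First case: b is odd or equal to a. Then the value can only vanish if the
   support is reduced to a, and this would force b = a. *)
have [vb|vb] := eqVneq (v b) 0.
  rewrite coef_form_amgm// vb mulr0 addr0 lt0r sumr_ge0 ?andbT => [|a' _]; last first.
    by rewrite !mulr_ge0// expR_ge0.
  apply/negP; rewrite psumr_eq0 => [/allP sum0|a' _]; last by rewrite !mulr_ge0// expR_ge0.
  have supa a' : a' != a -> lam a' = 0.
    move=> a'a; apply/eqP; apply: contraT => la'.
    have /andP[a'A ev'] := lamA _ la'.
    have := sum0 _ a'A; rewrite !mulf_eq0 (negPf la') expR_eq0/= /v (negPf a'a) ev'/=.
    by rewrite expR_eq0.
  have [a' la'] := weights_neq0 wlam.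
  have la : lam a != 0.
    by have [<-//|/supa la'0] := eqVneq a' a; rewrite la'0 eqxx in la'.
  have la1 : lam a = 1.
    move: lam1; rewrite (big_fsetD1 a)//= big1_seq ?addr0// => b'.
    by rewrite !inE => /andP[_ /andP[/supa]].
  have : pt a = pt b.
    rewrite -lamb (big_fsetD1 a)//= la1 scale1r big1_seq ?addr0// => b'.
    by rewrite !inE => /andP[_ /andP[/supa -> _]]; rewrite scale0r.
  by move=> /point_inj ab; rewrite ab lb eqxx in la.
have [ba evb] : b != a /\ even_mnm b.
  by move: vb; rewrite /v; case: ifP => [|/norP[ba /negPn evb]]; rewrite ?eqxx.
have la : lam a = 0.
  by apply/eqP; apply: contraT => la; have := nocirc _ _ (And4 wlam ind bA lb) la; rewrite evb.
have vL a' : lam a' != 0 -> v a' = expR (sqnorm a').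
  move=> la'; rewrite /v; have /andP[_ ->] := lamA _ la'.
  by case: eqP => // aa; rewrite aa la eqxx in la'.
apply: lt_le_trans (coef_form_amgm_ge _ wlam bA (amgm_sign_norm sb) vL).
rewrite mulr_gt0 ?expR_gt0// subr_gt0 /v (negPf ba) evb/= ger0_norm ?expR_ge0//.
by rewrite ltr_expR sqnorm_strict_convex.
Qed.

Lemma polys_onP A f : polys_on A f <-> forall m, m \notin A -> f@_m = 0.
Proof.
split=> [fA m mA|fA m].
  by apply/eqP; rewrite mcoeff_eq0; apply: contra mA => /fA.
by rewrite mcoeff_msupp; apply: contraNT => /fA ->.
Qed.

Lemma linear_form_sumX A (l : {mpoly R[n]} -> R) (s : seq 'X_{1..n}) c :
  linear_form_on (polys_on A) l -> {subset s <= A} ->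
  polys_on A (\sum_(a <- s) c a *: 'X_[a])
  /\ l (\sum_(a <- s) c a *: 'X_[a]) = \sum_(a <- s) c a * l 'X_[a].
Proof.
move=> lin; have X0 : polys_on A (0 : {mpoly R[n]}).
  by apply/polys_onP => m _; rewrite mcoeff0.
elim: s => [|a s IH] sA.
  rewrite !big_nil; split=> //.
  by have := lin 1 _ _ X0 X0; rewrite scale1r addr0 mul1r => l0; lra.
have [Xs ls] : polys_on A (\sum_(a <- s) c a *: 'X_[a])
    /\ l (\sum_(a <- s) c a *: 'X_[a]) = \sum_(a <- s) c a * l 'X_[a].
  by apply: IH => b bs; apply: sA; rewrite inE bs orbT.
have aA : a \in A by apply: sA; rewrite mem_head.
have Xa : polys_on A ('X_[a] : {mpoly R[n]}).
  apply/polys_onP => m mA; rewrite mcoeffX; case: eqP => // am.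
  by rewrite -am aA in mA.
rewrite !big_cons; split; last by rewrite lin// ls.
apply/polys_onP => m mA; rewrite mcoeffD mcoeffZ.
by rewrite (iffLR (polys_onP _ _) Xa)// (iffLR (polys_onP _ _) Xs)// mulr0 addr0.
Qed.

(** Let the coefficients of the circuit other than that of [a] be of order
    [exp (- T)]. The coefficient of the inner monomial is then of the larger
    order [exp (- T * (1 - lam a))], so a form that vanishes at [a], is finite
    elsewhere and positive at [b] takes a negative value on the AM-GM polynomial
    for large [T]. *)
Lemma monomial_not_exposed A S a b :
  circuit R A S b -> a \in S -> b != a -> even_mnm b ->
  ~ exposed (polys_on A) (sonc A) (ray ('X_[a] : {mpoly R[n]})).
Proof.
move=> circ aS ba evb [l [lin lr lK]].
have [lam [wlam ind lamS]] := circuit_weights circ.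
have bA : b \in A by case: circ => _ _ _ _ [].
have [lam0 lamA lam1 lamb] := wlam.
have lamAA a' : lam a' != 0 -> a' \in A by move=> /lamA/andP[].
have la : lam a != 0 by rewrite -lamS.
have lK0 f : sonc A f -> 0 <= l f.
  move=> fK; have [/lr ->//|rf] := pselect (ray 'X_[a] f).
  by apply/ltW/lK.
have lXa : l 'X_[a] = 0 by apply: lr; exists 1; rewrite ?scale1r.
have lXb : 0 < l 'X_[b].
  apply: lK; split; first exact: monomial_sonc.
  move=> [t _ /(congr1 (mcoeff b))]; rewrite mcoeffZ !mcoeffX eqxx eq_sym (negPf ba).
  by rewrite mulr0 => /eqP; rewrite oner_eq0.
pose c := \sum_(a' <- A) lam a' * l 'X_[a'].
(* With this T, exp (T * lam a) * l 'X_[b] > c follows from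
   exp x >= 1 + x. *)
pose T := c / (l 'X_[b] * lam a).
pose h a' := if a' == a then 0 else - T.
have := lK0 _ (amgm_sonc h wlam ind bA (_ : `|-1| <= 1)).
rewrite normrN normr1 => /(_ (lexx _)); apply/negP; rewrite -ltNge.
have [Xs ls] := linear_form_sumX (fun a => lam a * expR (h a)) lin (fun a aA => aA).
rewrite /amgm_poly addrC lin//; last first.
  by apply/polys_onP => m mA; rewrite mcoeffX; case: eqP => // bm; rewrite -bm bA in mA.
have -> : l (\sum_(a <- A) (lam a * expR (h a)) *: 'X_[a]) = expR (- T) * c.
  rewrite ls mulr_sumr; apply: eq_bigr => a' _; rewrite /h.
  by case: eqP => [->|_]; rewrite ?lXa ?mulr0//; ring.
have -> : \sum_(a <- A) lam a * h a = T * lam a - T.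
  rewrite (big_fsetD1 a) ?lamAA//= /h eqxx mulr0 add0r.
  move: lam1; rewrite (big_fsetD1 a) ?lamAA//= => lam1.
  have -> : T * lam a - T = (1 - lam a) * - T by ring.
  rewrite -lam1 addrAC subrr add0r mulr_suml; apply: eq_big_seq => a'.
  by rewrite !inE => /andP[/negPf -> _].
rewrite mulN1r mulNr addrC subr_lt0 addrC expRD -mulrA ltr_pM2l ?expR_gt0//.
have cE : c = T * lam a * l 'X_[b].
  by rewrite /T; field; rewrite la gt_eqF.
rewrite [ltLHS]cE ltr_pM2r//.
by apply: lt_le_trans (expR_ge1Dx _); rewrite ltrDr.
Qed.

End ExposedRays.

(** * Rays of AM-GM polynomials are exposed *)

Section AmGmRays.
Variables (R : realType) (n : nat).
Local Notation pt := (@Defs.point R n).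
Implicit Types (A S : {fset 'X_{1..n}}) (a b p : 'X_{1..n}).
Implicit Types (lam mu nu h v D F : 'X_{1..n} -> R) (f g : {mpoly R[n]}).

Lemma delta_weights A a : a \in A -> even_mnm a ->
  weights A (fun c => (c == a)%:R : R) a.
Proof.
move=> aA ev; split=> [c|c||]; first exact: ler0n.
- by have [->|_] := eqVneq c a; rewrite ?aA ?ev ?eqxx.
- exact: sum_delta1.
- exact: sum_delta.
Qed.

(** Replacing in [lam] as much as possible of the combination [mu] by the
    point [a] that it represents: the largest [t] that keeps all weights
    nonnegative removes a point of the support, which is what keeps the support
    affinely independent once [a] has entered. *)
Lemma exchange_weights A lam mu a b : weights A lam b -> indep_support A lam ->
  weights A mu a -> a \in A -> even_mnm a ->
  (forall c, lam c = 0 -> mu c = 0) -> lam a = 0 ->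
  exists2 t : R, 0 < t &
    let lam2 c := lam c - t * mu c + t * (c == a)%:R in
    weights A lam2 b /\ indep_support A lam2.
Proof.
move=> wlam ind wmu aA eva sub la.
have [lam0 lamA lam1 lamb] := wlam; have [mu0 muA mu1 mua] := wmu.
have [c1 mc1] := weights_neq0 wmu.
have c1A : c1 \in A by have /andP[] := muA _ mc1.
pose P (c : A) := mu (val c) != 0.
pose ratio (c : A) := lam (val c) / mu (val c).
have P1 : P [` c1A]%fset by [].
case: (arg_minP ratio P1) => -[c0 c0A]; rewrite /P/= => mc0 minc0.
have lc0 : lam c0 != 0 by apply: contraNneq mc0 => /sub ->.
pose t := lam c0 / mu c0.
have t0 : 0 < t by rewrite divr_gt0// lt0r ?lc0 ?mc0 ?lam0 ?mu0.
exists t => //.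
set lam2 := fun c => lam c - t * mu c + t * (c == a)%:R.
have lam2a : lam2 a = t by rewrite /lam2 la sub// eqxx mulr0 subr0 add0r mulr1.
have lam2c0 : lam2 c0 = 0.
  have /negPf c0a : c0 != a by apply: contraNneq lc0 => ->; rewrite la.
  by rewrite /lam2 c0a mulr0 addr0 /t divfK// subrr.
have sums (V : lmodType R) (G : 'X_{1..n} -> V) :
    \sum_(c <- A) lam2 c *: G c
    = \sum_(c <- A) lam c *: G c - t *: \sum_(c <- A) mu c *: G c + t *: G a.
  rewrite -(sum_delta G aA) !scaler_sumr -sumrB -big_split/=.
  by apply: eq_bigr => c _; rewrite scalerDl scalerBl !scalerA.
split.
  split=> [c|c||].
  - rewrite /lam2 addr_ge0//; last by rewrite mulr_ge0// ltW.
    rewrite subr_ge0; have [->|mc] := eqVneq (mu c) 0; first by rewrite mulr0.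
    have cA : c \in A by have /andP[] := muA _ mc.
    have := minc0 [` cA]%fset mc; rewrite /ratio/= -/t ler_pdivlMr//.
    by rewrite lt0r mc mu0.
  - have [lc|/lamA//] := eqVneq (lam c) 0.
    rewrite /lam2 lc sub// mulr0 subr0 add0r.
    by have [->|_] := eqVneq c a; rewrite ?aA// mulr0 eqxx.
  - have := sums R^o (fun=> 1); under eq_bigr do rewrite [_ *: _]mulr1.
    move=> ->; under eq_bigr do rewrite [_ *: _]mulr1.
    rewrite lam1; under eq_bigr do rewrite [_ *: _]mulr1.
    by rewrite mu1 [_ *: _]mulr1 subrK.
  - by rewrite sums lamb mua subrK.
move=> nu nu0 nus nup.
pose nu' c := nu c - nu a * (c == a)%:R + nu a * mu c.
have nu'0 : forall c, nu' c = 0.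
  apply: ind => [c lc||].
  - rewrite /nu' sub// mulr0 addr0; case: eqP => [->|/eqP/negPf ca].
      by rewrite mulr1 subrr.
    by rewrite mulr0 subr0 nu0// /lam2 lc sub// ca !mulr0 subrr addr0.
  - by rewrite big_split sumrB/= -!mulr_sumr nus mu1 sum_delta1//; ring.
  - rewrite (eq_bigr (fun c => nu c *: pt c - nu a *: ((c == a)%:R *: pt c)
        + nu a *: (mu c *: pt c))); last first.
      by move=> c _; rewrite scalerDl scalerBl !scalerA.
    by rewrite big_split sumrB/= -!scaler_sumr nup mua sum_delta// add0r addNr.
have nua : nu a = 0.
  have := nu'0 c0; rewrite /nu' nu0// [c0 == a](_ : _ = false); last first.
    by apply: contraNF lc0 => /eqP ->; rewrite la.
  by rewrite mulr0 subr0 add0r => /eqP; rewrite mulf_eq0 (negPf mc0) orbF => /eqP.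
by move=> c; have := nu'0 c; rewrite /nu' nua !mul0r subr0 addr0.
Qed.

(** Suppose that the simplex of the circuit contained another even point
    [a] of [A]. By the exchange above, the AM-GM polynomial would be the sum of
    [t] times an AM-GM polynomial with inner point [a] and one in which [a] is
    part of the support; the first has no term in [b], so it is not on the
    ray. *)
Lemma reduced_circuit A lam h s b : amgm_circuit A lam b -> `|s| = 1 ->
  (forall y z, amgm_poly A lam h s b = y + z -> sonc A y -> sonc A z ->
     ray (amgm_poly A lam h s b) y) ->
  forall mu a, a \in A -> even_mnm a -> weights A mu a ->
  (forall c, lam c = 0 -> mu c = 0) -> lam a != 0 \/ a = b.
Proof.
move=> [wlam ind bA lb] s1 ext mu a aA eva wmu sub.
have [la|] := eqVneq (lam a) 0; last by left.
right; apply/eqP; apply: contraT => ab.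
have [t t0 [wlam2 ind2]] := exchange_weights wlam ind wmu aA eva sub la.
set lam2 := fun c => _ in wlam2 ind2.
have lamA c : lam c != 0 -> c \in A by case: wlam => _ lamA _ _ /lamA/andP[].
have lam2A c : lam2 c != 0 -> c \in A by case: wlam2 => _ lam2A _ _ /lam2A/andP[].
have muA c : mu c != 0 -> c \in A by case: wmu => _ muA _ _ /muA/andP[].
have indmu : indep_support A mu.
  by move=> nu nu0; apply: ind => c /sub; exact: nu0.
pose H := \sum_(c <- A) mu c * h c.
pose h2 c := if c == a then H else h c.
pose y := t *: amgm_poly A mu h (-1) a.
pose z := amgm_poly A lam2 h2 s b.
have sumh : \sum_(c <- A) lam2 c * h2 c = \sum_(c <- A) lam c * h c.
  rewrite (eq_bigr (fun c => lam c * h c - t * (mu c * h c) + t * H * (c == a)%:R)).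
    by rewrite big_split sumrB/= -!mulr_sumr sum_delta1// -/H mulr1 subrK.
  move=> c _; rewrite /lam2 /h2; case: eqP => [->|_]; last by rewrite /= !mulr0; ring.
  by rewrite la sub//= !mulr1; ring.
have gyz : amgm_poly A lam h s b = y + z.
  apply/mpolyP => m; rewrite [RHS]mcoeffD /y /z [in RHS]mcoeffZ !mcoeff_amgm// sumh -/H addrA.
  congr (_ + _); rewrite /lam2 /h2 eq_sym; case: eqP => [->|_]; last by rewrite /= !mulr0; ring.
  by rewrite la sub//= !mulr1; ring.
have yK : sonc A y.
  by apply: soncZ; [exact: ltW|apply: amgm_sonc; rewrite // normrN normr1].
have zK : sonc A z by apply: amgm_sonc; rewrite ?s1.
have [k _ yE] := ext _ _ gyz yK zK.
have := congr1 (mcoeff b) yE.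
rewrite /y !mcoeffZ !mcoeff_amgm// lb sub// (negPf ab) eqxx !mul0r mulr0 !add0r mulr0 mulr1.
move=> /esym/eqP; rewrite mulf_eq0 mulf_eq0 expR_eq0 orbF -[s == 0]normr_eq0 s1 oner_eq0 orbF.
move=> /eqP k0; have := congr1 (mcoeff a) yE; rewrite k0 scale0r mcoeff0.
rewrite /y mcoeffZ mcoeff_amgm// sub// mul0r add0r eqxx mulr1 mulN1r => /eqP.
by rewrite mulf_eq0 oppr_eq0 expR_eq0 orbF gt_eqF.
Qed.

(** Convexity tested on the even points of [A] only, for functions that are
    given on exponents. *)
Definition jensen_convex A D := forall mu p, weights A mu p ->
  D p <= \sum_(a <- A) mu a * D a.

Definition jensen_affine A F := forall mu p, weights A mu p ->
  F p = \sum_(a <- A) mu a * F a.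

Lemma jensen_affine_form A c u : jensen_affine A (fun a => affine_form c u (pt a)).
Proof. by move=> mu p [_ _ mu1 <-]; rewrite affine_form_sum. Qed.

Lemma jensen_affine_cst A k : jensen_affine A (fun=> k).
Proof. by move=> mu p [_ _ mu1 _]; rewrite -mulr_suml mu1 mul1r. Qed.

Lemma jensen_affineB A F G : jensen_affine A F -> jensen_affine A G ->
  jensen_affine A (fun a => F a - G a).
Proof.
move=> Faff Gaff mu p wmu; rewrite (Faff _ _ wmu) (Gaff _ _ wmu) -sumrB.
by apply: eq_bigr => a _; rewrite mulrBr.
Qed.

Lemma jensen_affine_sum A (s : seq 'X_{1..n}) (F : 'X_{1..n} -> 'X_{1..n} -> R) :
  (forall c, jensen_affine A (F c)) -> jensen_affine A (fun a => \sum_(c <- s) F c a).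
Proof.
move=> Faff mu p wmu; under [RHS]eq_bigr do rewrite mulr_sumr.
by rewrite exchange_big/=; apply: eq_bigr => c _; exact: Faff.
Qed.

Lemma jensen_affineZ A k F : jensen_affine A F -> jensen_affine A (fun a => F a * k).
Proof.
move=> Faff mu p wmu; rewrite (Faff _ _ wmu) mulr_suml.
by apply: eq_bigr => a _; rewrite mulrA.
Qed.

Lemma jensen_convex_norm A F : jensen_affine A F -> jensen_convex A (fun a => `|F a|).
Proof.
move=> Faff mu p wmu; rewrite (Faff _ _ wmu) (le_trans (ler_norm_sum _ _ _))//.
apply: ler_sum => a _; rewrite normrM ger0_norm//; by case: wmu.
Qed.

Lemma jensen_convexD A D D' : jensen_convex A D -> jensen_convex A D' ->
  jensen_convex A (fun a => D a + D' a).
Proof.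
move=> Dc Dc' mu p wmu; rewrite (le_trans (lerD (Dc _ _ wmu) (Dc' _ _ wmu)))//.
by rewrite -big_split/=; apply: ler_sum => a _; rewrite mulrDr.
Qed.

Lemma jensen_convex_sum A (I : Type) (s : seq I) (D : I -> 'X_{1..n} -> R) :
  (forall i, jensen_convex A (D i)) -> jensen_convex A (fun a => \sum_(i <- s) D i a).
Proof.
move=> Dc mu p wmu; under [leRHS]eq_bigr do rewrite mulr_sumr.
by rewrite exchange_big/=; apply: ler_sum => i _; exact: Dc.
Qed.

(** In barycentric coordinates [B], the simplex is cut out by [B >= 0],
    [\sum B = 1] and [p = \sum_a B a * a]. The violations of these conditions,
    [|B a| - B a] for the first one, are convex functions, and so is their
    sum. *)
Lemma simplex_gauge A lam b : weights A lam b -> indep_support A lam ->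
  exists D : 'X_{1..n} -> R, [/\ jensen_convex A D, forall p, 0 <= D p
    & forall p, D p = 0 <->
        exists2 mu : 'X_{1..n} -> R, weights A mu p & forall a, lam a = 0 -> mu a = 0].
Proof.
move=> [lam0 lamA lam1 lamb] ind.
have lamAA a' : lam a' != 0 -> a' \in A by move=> /lamA/andP[].
have [c [u cu]] := bary_coords_exist lamAA ind.
pose B a p := affine_form (c a) (u a) (pt p).
have Baff a : jensen_affine A (B a) by exact: jensen_affine_form.
pose neg p := \sum_(a <- A) (`|B a p| - B a p).
pose tot p := `|1 - \sum_(a <- A) B a p|.
pose res p := \sum_i `|(p i)%:R - \sum_(a <- A) B a p * (a i)%:R|.
have neg0 p : 0 <= neg p by apply: sumr_ge0 => a _; rewrite subr_ge0 ler_norm.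
have tot0 p : 0 <= tot p by exact: normr_ge0.
have res0 p : 0 <= res p by exact: sumr_ge0.
exists (fun p => neg p + tot p + res p); split.
- apply: jensen_convexD; first apply: jensen_convexD.
  + apply: jensen_convex_sum => a; apply: jensen_convexD; first exact: jensen_convex_norm.
    move=> mu p wmu; rewrite (Baff _ _ _ wmu) -sumrN; apply: ler_sum => a' _.
    by rewrite mulrN.
  + apply: jensen_convex_norm; apply: jensen_affineB; first exact: jensen_affine_cst.
    exact: jensen_affine_sum.
  + apply: jensen_convex_sum => i; apply: jensen_convex_norm; apply: jensen_affineB.
      move=> mu p [_ _ _ /(congr1 (fun y : 'rV[R]_n => y 0 i))]; rewrite mxE => <-.
      by rewrite summxE; apply: eq_bigr => a _; rewrite !mxE.
    by apply: jensen_affine_sum => a; exact: jensen_affineZ.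
- by move=> p; rewrite !addr_ge0.
move=> p; split=> [/eqP|[mu wmu sub]].
  rewrite !paddr_eq0 ?addr_ge0// => /andP[/andP[neg_p tot_p] res_p].
  have Bge0 a : 0 <= B a p.
    have [la|/lamAA aA] := eqVneq (lam a) 0; first by rewrite /B cu.2.
    move: neg_p; rewrite psumr_eq0 => [/allP/(_ a aA)|a' _]; last first.
      by rewrite subr_ge0 ler_norm.
    by rewrite subr_eq0 => /eqP <-.
  exists (fun a => B a p); last by move=> a la; rewrite /B cu.2.
  split=> // [a Ba||].
  - by apply: lamA; apply: contra_neq Ba => la; rewrite /B cu.2.
  - by move: tot_p; rewrite normr_eq0 subr_eq0 => /eqP <-.
  - apply/rowP => i; rewrite summxE mxE; under eq_bigr do rewrite !mxE.
    move: res_p; rewrite psumr_eq0// => /allP/(_ i (mem_index_enum _)).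
    by rewrite normr_eq0 subr_eq0 => /eqP <-.
have [mu0 muA mu1 mup] := wmu.
have BE a : B a p = mu a by rewrite /B -mup (bary_coordsE lamAA cu).
rewrite /neg /tot /res; under eq_bigr do rewrite BE ger0_norm// subrr.
rewrite big1//; under eq_bigr do rewrite BE.
rewrite mu1 subrr normr0 big1 ?addr0// => i _.
have -> : (p i)%:R = \sum_(a <- A) mu a * (a i)%:R.
  have := congr1 (fun y : 'rV[R]_n => y 0 i) mup; rewrite mxE => <-.
  by rewrite summxE; apply: eq_bigr => a _; rewrite !mxE.
by under [X in _ - X]eq_bigr do rewrite BE; rewrite subrr normr0.
Qed.

(** The exponent function [Q] vanishes on the simplex and equals
    [M * D + |a|^2 - K] outside, where [D] is the gauge of the simplex and [K]
    bounds all [|a|^2]. For large [M] this is positive outside the simplex, and it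
    is at most zero on it, so [Q] is the maximum of zero and a strictly convex
    function on [A]. A circuit whose inner point is outside the simplex then
    satisfies a strict inequality; if the inner point is inside, so is the whole
    support unless the inequality is strict, and since the circuit [lam] is reduced
    the only such circuit with an even inner point or inner point [b] is [lam]
    itself. *)
Lemma peak_function A lam b : amgm_circuit A lam b ->
  (forall mu a, a \in A -> even_mnm a -> weights A mu a ->
    (forall c, lam c = 0 -> mu c = 0) -> lam a != 0 \/ a = b) ->
  exists Q : 'X_{1..n} -> R,
    [/\ forall a, lam a != 0 -> Q a = 0, Q b = 0
      & forall lam' b', amgm_circuit A lam' b' -> even_mnm b' \/ b' = b ->
          Q b' < \sum_(a <- A) lam' a * Q a \/ b' = b /\ lam' = lam].
Proof.
move=> [wlam ind bA lb] red.
have [D [Dconv D0 DP]] := simplex_gauge wlam ind.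
have [lam0 lamA lam1 lamb] := wlam.
have Dlam a : lam a != 0 -> D a = 0.
  move=> la; have /andP[aA ev] := lamA _ la.
  apply/DP; exists (fun c => (c == a)%:R); first exact: delta_weights.
  by move=> c lc; case: eqP => // ca; rewrite -ca lc eqxx in la.
have Db : D b = 0 by apply/DP; exists lam.
have sqn0 a : 0 <= sqnorm R a by apply: sumr_ge0 => i _; exact: sqr_ge0.
pose K := \sum_(a <- A) sqnorm R a.
have Kge a : a \in A -> sqnorm R a <= K.
  by move=> aA; rewrite /K (big_fsetD1 a)//= lerDl sumr_ge0.
have K0 : 0 <= K by exact: sumr_ge0.
(* Terms with D a = 0 contribute 0, as the inverse of 0 is 0. *)
pose M := \sum_(a <- A) (K + 1) / D a.
have M0 : 0 <= M by apply: sumr_ge0 => a _; rewrite divr_ge0// addr_ge0.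
have MD a : a \in A -> D a != 0 -> K < M * D a.
  move=> aA Da; have Da0 : 0 < D a by rewrite lt0r Da D0.
  rewrite -ltr_pdivrMr// /M (big_fsetD1 a)//=.
  apply: (@lt_le_trans _ _ ((K + 1) / D a)); first by rewrite ltr_pM2r ?invr_gt0// ltrDl.
  by rewrite lerDl sumr_ge0// => a' _; rewrite divr_ge0// addr_ge0.
pose q a := M * D a + (sqnorm R a - K).
pose Q a := if D a == 0 then 0 else q a.
have Qge0 a : a \in A -> 0 <= Q a ?= iff (D a == 0).
  move=> aA; rewrite /Q; case: eqP => [_|/eqP Da]; first by split; rewrite ?eqxx.
  have q0 : 0 < q a.
    by rewrite /q addrCA ltr_wpDl// subr_gt0 MD.
  by split; [exact: ltW|rewrite lt_eqF].
have qQ a : a \in A -> q a <= Q a.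
  move=> aA; rewrite /Q; case: eqP => // Da.
  by rewrite /q Da mulr0 add0r subr_le0 Kge.
exists Q; split=> [a la||lam' b' [wlam' ind' b'A lb'] evb'].
- by rewrite /Q Dlam ?eqxx.
- by rewrite /Q Db eqxx.
have [lam'0 lam'A lam'1 lam'b] := wlam'.
have [Db'|Db'] := eqVneq (D b') 0; last first.
  left; rewrite {1}/Q (negPf Db').
  apply: (@lt_le_trans _ _ (\sum_(a <- A) lam' a * q a)); last first.
    by rewrite big_seq [leRHS]big_seq; apply: ler_sum => a aA; rewrite ler_wpM2l// qQ.
  rewrite (eq_bigr (fun a => M * (lam' a * D a) + (lam' a * sqnorm R a - lam' a * K))).
    rewrite big_split sumrB/= -mulr_sumr -mulr_suml lam'1 mul1r ler_ltD//.
      by rewrite ler_wpM2l// Dconv.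
    by rewrite ltrD2r sqnorm_strict_convex.
  by move=> a _; rewrite /q; ring.
rewrite {1}/Q Db' eqxx.
have term0 a : a \in A -> 0 <= lam' a * Q a.
  by move=> aA; rewrite mulr_ge0//; have [] := Qge0 a aA.
have [|sum0] := ltP 0 (\sum_(a <- A) lam' a * Q a); first by left.
have D' a : lam' a != 0 -> D a = 0.
  move=> la; have /andP[aA _] := lam'A _ la; apply/eqP.
  have [_ <-] := Qge0 a aA; move: sum0; rewrite big_seq.
  rewrite le_eqVlt ltNge sumr_ge0// orbF psumr_eq0// => /allP/(_ a aA).
  by rewrite aA mulf_eq0 (negPf la)/= eq_sym.
right.
have [lb'0|b'b] : lam b' != 0 \/ b' = b.
  case: evb' => [evb'|]; last by right.
  by have /DP[mu wmu sub] := Db'; exact: red wmu sub.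
(* An inner point that is a vertex b' of the simplex: its combination lam' of
  points of the simplex can only use b' itself. *)
- exfalso.
  have lamAA a' : lam a' != 0 -> a' \in A by move=> /lamA/andP[].
  have [c [u cu]] := bary_coords_exist lamAA ind.
  have [a la'] := weights_neq0 wlam'.
  have /andP[aA _] := lam'A _ la'.
  have BE a' mu : weights A mu a' -> (forall c, lam c = 0 -> mu c = 0) ->
      forall a, affine_form (c a) (u a) (pt a') = mu a.
    by move=> [_ _ mu1 <-] sub a0; exact: (bary_coordsE lamAA cu).
  have Bge0 a' a0 : lam' a' != 0 -> 0 <= affine_form (c a0) (u a0) (pt a').
    by move=> /D'/DP[mu wmu sub]; rewrite (BE _ _ wmu sub); case: wmu.
  have /DP[mu wmu sub] := D' _ la'.
  have muE a0 : a0 != b' -> mu a0 = 0.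
    move=> /negPf a0b'; have := jensen_affine_form (c a0) (u a0) wlam'.
    rewrite cu.1// a0b' => /esym/eqP; rewrite psumr_eq0 => [/allP/(_ a aA)|a' _].
      by rewrite mulf_eq0 (negPf la') (BE _ _ wmu sub) => /eqP.
    have [->|la0] := eqVneq (lam' a') 0; first by rewrite mul0r.
    by rewrite mulr_ge0// Bge0.
  have [_ _ mu1 mua] := wmu.
  have sumb' (V : lmodType R) (G : 'X_{1..n} -> V) :
      \sum_(a <- A) mu a *: G a = mu b' *: G b'.
    rewrite (big_fsetD1 b')//= big1_seq ?addr0// => a0.
    by rewrite !inE => /andP[_ /andP[/muE -> _]]; rewrite scale0r.
  have mub' : mu b' = 1.
    have := sumb' R^o (fun=> 1); under eq_bigr do rewrite [_ *: _]mulr1.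
    by rewrite mu1 [_ *: _]mulr1 => <-.
  move: mua; rewrite sumb' mub' scale1r => /point_inj b'a.
  by rewrite -b'a lb' eqxx in la'.
split=> //; apply/funext => a; subst b'.
apply: (weights_unique wlam ind wlam') => {}a la.
apply/eqP; apply: contraT => la'.
have /andP[aA eva] := lam'A _ la'; have /DP[mu wmu sub] := D' _ la'.
have [|ab] := red _ _ aA eva wmu sub; first by rewrite la eqxx.
by rewrite ab lb' eqxx in la'.
Qed.

(** Evaluation at a zero of the polynomial can also vanish on other AM-GM
    polynomials. Up to a constant, [F] gives the logarithms of the absolute
    values of the monomials at this zero; it is replaced by [L = F + Q], and the
    odd monomials other than [b] are sent to zero. On the given circuit nothing
    changes; on every other circuit the value becomes positive. On the circuit itself the equality case of Jensen's inequality
    leaves only multiples of the given polynomial. *)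
Lemma amgm_exposed A lam h s b : amgm_circuit A lam b -> amgm_sign s b ->
  (forall y z, amgm_poly A lam h s b = y + z -> sonc A y -> sonc A z ->
     ray (amgm_poly A lam h s b) y) ->
  exposed (polys_on A) (sonc A) (ray (amgm_poly A lam h s b)).
Proof.
move=> circ sb ext; have s1 := amgm_sign_norm sb.
have [Q [Qlam Qb Qcirc]] := peak_function circ (reduced_circuit circ s1 ext).
have [wlam ind bA lb] := circ; have [lam0 lamA lam1 lamb] := wlam.
have lamAA a : lam a != 0 -> a \in A by move=> /lamA/andP[].
have [w0 [w wh]] := affine_interpolation (fun a => - h a) lamAA ind.
pose F a := affine_form w0 w (pt a).
have Faff : jensen_affine A F by exact: jensen_affine_form.
have Fb : F b = - \sum_(a <- A) lam a * h a.
  rewrite (Faff _ _ wlam) -sumrN; apply: eq_bigr => a _.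
  have [->|la] := eqVneq (lam a) 0; first by rewrite !mul0r oppr0.
  by rewrite /F wh// mulrN.
pose L a := F a + Q a.
pose v a := if a == b then - s * expR (L b) else if even_mnm a then expR (L a) else 0.
have s2 : s * s = 1 by case: sb => [->|[-> _]]; ring.
have vev a : even_mnm a -> v a = expR (L a).
  rewrite /v; case: eqP => [-> evb|_ ->//].
  by case: sb => [->|[_]]; rewrite ?evb// opprK mul1r.
have vlam a : lam a != 0 -> v a = expR (- h a).
  by move=> la; have /andP[_ /vev ->] := lamA _ la; rewrite /L Qlam// addr0 /F wh.
have vb : v b = - s * expR (- \sum_(a <- A) lam a * h a).
  by rewrite /v eqxx /L Qb addr0 Fb.
have valueE h' s' : coef_form A v (amgm_poly A lam h' s' b)
    = \sum_(a <- A) lam a * expR (h' a - h a)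
      - s * s' * expR (\sum_(a <- A) lam a * (h' a - h a)).
  rewrite coef_form_amgm// vb; congr (_ + _).
    apply: eq_bigr => a _; have [->|la] := eqVneq (lam a) 0; first by rewrite !mul0r.
    by rewrite vlam// expRD mulrA.
  under [X in _ = - (_ * expR X)]eq_bigr do rewrite mulrBr.
  by rewrite sumrB expRD; ring.
apply: (@exposed_ray _ _ A v).
  rewrite valueE s2 [X in expR X]big1 => [|a _]; last by rewrite subrr mulr0.
  by under eq_bigr do rewrite subrr expR0 mulr1; rewrite lam1 expR0 mulr1 subrr.
move=> _ [[a [aA eva ->]]|[lam' [h' [s' [b' [circ' sb' ->]]]]]].
  rewrite coef_formX// vev//; split; first exact: expR_ge0.
  by move/eqP; rewrite expR_eq0.
have [wlam' ind' b'A lb'] := circ'; have [lam'0 lam'A lam'1 lam'b] := wlam'.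
have s'1 := amgm_sign_norm sb'.
have strict : `|v b'| < expR (\sum_(a <- A) lam' a * L a) ->
    0 <= coef_form A v (amgm_poly A lam' h' s' b')
    /\ (coef_form A v (amgm_poly A lam' h' s' b') = 0 ->
        ray (amgm_poly A lam h s b) (amgm_poly A lam' h' s' b')).
  move=> vlt; suff lt0 : 0 < coef_form A v (amgm_poly A lam' h' s' b').
    by split=> [|l0]; [exact: ltW|move: lt0; rewrite l0 ltxx].
  apply: lt_le_trans (coef_form_amgm_ge h' wlam' b'A s'1 _).
    by rewrite mulr_gt0 ?expR_gt0// subr_gt0; exact: vlt.
  by move=> a /lam'A/andP[_ /vev].
have [evb'|] := boolP (even_mnm b' || (b' == b)); last first.
  rewrite negb_or => /andP[evb' b'b]; apply: strict.
  by rewrite /v (negPf b'b) (negPf evb') normr0 expR_gt0.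
have {}evb' : even_mnm b' \/ b' = b by case/orP: evb' => [|/eqP]; [left|right].
have [Qlt|[b'E lam'E]] := Qcirc _ _ circ' evb'.
  apply: strict; apply: (@le_lt_trans _ _ (expR (L b'))).
    rewrite /v; case: eqP => [->|_].
      by rewrite normrM normrN s1 mul1r ger0_norm// expR_ge0.
    by case: ifP => _; rewrite ?normr0 ?ger0_norm ?expR_ge0.
  rewrite ltr_expR /L (eq_bigr (fun a => lam' a * F a + lam' a * Q a)).
    by rewrite big_split/= -(Faff _ _ wlam') ltrD2l.
  by move=> a _; rewrite mulrDr.
subst b' lam'.
rewrite valueE; have [jle jeq] := jensen_expR (fun a => h' a - h a) lam0 lam1.
set m := \sum_(a <- A) lam a * (h' a - h a) in jle jeq *.
set J := \sum_(a <- A) lam a * expR (h' a - h a) in jle jeq *.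
have [ss|ss] : s' = s \/ s * s' = -1.
  by case: sb sb' => [->|[-> _]] [->|[-> _]]; rewrite ?mulN1r ?mul1r; auto.
- rewrite ss s2 mul1r; split; first by rewrite subr_ge0.
  move=> /eqP; rewrite subr_eq0 eq_sym jeq => /allP hm.
  have hE a : lam a != 0 -> h' a = h a + m.
    move=> la; have := hm a (lamAA _ la); rewrite (negPf la)/= => /eqP <-.
    by rewrite addrC subrK.
  exists (expR m); first exact: expR_ge0.
  rewrite /amgm_poly scalerDr scaler_sumr scalerA; congr (_ + _ *: _).
    apply: eq_bigr => a _; rewrite scalerA; congr (_ *: _).
    have [->|la] := eqVneq (lam a) 0; first by rewrite !mul0r mulr0.
    by rewrite hE// expRD; ring.
  rewrite mulrCA -expRD; congr (_ * expR _).
  rewrite (eq_bigr (fun a => lam a * m + lam a * h a)).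
    by rewrite big_split/= -mulr_suml lam1 mul1r.
  move=> a _; have [->|la] := eqVneq (lam a) 0; first by rewrite !mul0r addr0.
  by rewrite hE//; ring.
have E0 : 0 < expR m by exact: expR_gt0.
rewrite ss mulN1r opprK; have lt0 : 0 < J + expR m.
  by rewrite addr_gt0// (lt_le_trans E0 jle).
by split=> [|l0]; [exact: ltW|move: lt0; rewrite l0 ltxx].
Qed.

End AmGmRays.

(** * Which extreme rays are exposed *)

Theorem theorem1p1 (R : realType) (n : nat) (A : {fset 'X_{1..n}})
    (r : set {mpoly R[n]}) (hr : extreme_ray (sonc A) r) :
  ~ exposed (polys_on A) (sonc A) r <->
  exists a : 'X_{1..n},
    [/\ a \in A, r = ray ('X_[a] : {mpoly R[n]})
      & exists (S : {fset 'X_{1..n}}) (b : 'X_{1..n}),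
          [/\ circuit R A S b, a \in S, b != a & even_mnm b]].
Proof.
split=> [nexp|[a [aA -> [S [b [circ aS ba evb]]]]]]; last first.
  exact: monomial_not_exposed circ aS ba evb.
have [g [gA rE ext]] := extreme_ray_generator hr; subst r.
case: gA ext nexp => [[a [aA eva ->]] _ nexp
                     |[lam [h [s [b [circ sb ->]]]]] ext []]; last first.
  exact: amgm_exposed.
exists a; split=> //; apply: contra_notP nexp => nocirc.
apply: monomial_exposed => // lam b [wlam ind bA lb] la.
apply/negP => evb; apply: nocirc; exists (supp A lam), b; split=> //.
- exact: weights_circuit.
- by rewrite in_supp// => a' la'; case: wlam => _ /(_ _ la')/andP[].
- by apply: contraNneq la => <-; rewrite lb.
Qed.
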